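(* Let $\phi\in L^2(0,\infty)\cap\mathcal W$ with $\phi(x)>0$ for all $x\ge 0$, and let $\psi$, $G(\cdot,\cdot)$, $G_\gamma$, $H_\gamma$ and $\mathcal D_\gamma$ be defined from $\phi$ as in the context. Assume that $G(\cdot,\cdot)$ is the kernel of a bounded operator on $L^2(0,\infty)$. Then for all $\gamma\in\mathbf C\setminus\{0\}$ one has $\mathrm{Dom}(H_\gamma)=\mathrm{Ran}(G_\gamma)=\mathcal D_\gamma$. If $g\in\mathcal D_\gamma$ then $$H_\gamma g=\phi^{-1}(\phi' g-\phi g')'.$$ If $g_1,g_2\in\mathcal D_\gamma$ then $$\langle H_\gamma g_1,g_2\rangle=\int_0^\infty(\phi g_1'-\phi' g_1)(\phi\overline{g_2'}-\phi'\overline{g_2})\,\phi^{-2}\,dx+\frac{g_1(0)\overline{g_2(0)}}{\gamma\,\phi(0)^2}.$$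
   Context: $\mathcal W=W^{1,2}_{\rm loc}[0,\infty)$ is the set of continuous functions $f$ on $[0,\infty)$ for which there is $g\in L^2_{\rm loc}[0,\infty)$ (that is, $g\in L^2(0,a)$ for every $a>0$) with $f(x)=f(0)+\int_0^x g(s)\,ds$ for all $x\ge0$; such $g$ is unique a.e., is called the weak derivative of $f$, and is written $f'$. Identities involving weak derivatives hold almost everywhere; a statement such as $\phi g'-\phi' g\in\mathcal W$ means that the function agrees a.e. with an element of $\mathcal W$, and its value at $0$ is that of this continuous representative. Given $\phi$, put $$\psi(x)=\phi(x)\int_0^x\frac{ds}{\phi(s)^2},\qquad G(x,y)=\begin{cases}\psi(x)\phi(y)&0\le x\le y<\infty,\\ \phi(x)\psi(y)&0\le y\le x<\infty.\end{cases}$$ A function $K(x,y)$ is the kernel of a bounded operator $K$ if $(Kf)(x)=\int_0^\infty K(x,y)f(y)\,dy$ defines a bounded operator on the complex Hilbert space $L^2(0,\infty)$. For $\gamma\in\mathbf C\setminus\{0\}$ put $\xi=\psi+\gamma\phi$ and $$G_\gamma(x,y)=\begin{cases}\xi(x)\phi(y)&0\le x\le y<\infty,\\ \phi(x)\xi(y)&0\le y\le x<\infty.\end{cases}$$ When $G$ is bounded it is known that $G_\gamma(\cdot,\cdot)$ is the kernel of a bounded injective operator $G_\gamma$ on $L^2(0,\infty)$ with dense range, and $H_\gamma=G_\gamma^{-1}$ with $\mathrm{Dom}(H_\gamma)=\mathrm{Ran}(G_\gamma)$. The inner product is $\langle f,g\rangle=\int_0^\infty f\overline g\,dx$. $\mathcal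 D_\gamma$ is the set of functions $g$ on $[0,\infty)$ such that: ($\mathcal D1$) $g\in L^2(0,\infty)\cap\mathcal W$; ($\mathcal D2\gamma$) $(\phi g'-\phi' g)(0)=\dfrac{g(0)}{\gamma\phi(0)}$; ($\mathcal D3$) $\phi g'-\phi' g\in\mathcal W$; ($\mathcal D4$) $\phi^{-1}(\phi g'-\phi' g)'\in L^2(0,\infty)$; ($\mathcal D5$) $\lim_{x\to\infty}g(x)/\psi(x)=0$. *)

(* Defs.v *)
From HB Require Import structures.
From mathcomp Require Import all_boot all_order all_algebra.
From mathcomp Require Import complex.
From mathcomp Require Import all_classical all_reals all_analysis.
Set Implicit Arguments.
Unset Strict Implicit.
Unset Printing Implicit Defensive.
Import Order.TTheory GRing.Theory Num.Theory.
Import numFieldNormedType.Exports.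
Local Open Scope classical_set_scope.
Local Open Scope ring_scope.
Local Open Scope complex_scope.

(* Functions on [0, oo) are functions on R of which only the
   values at points x >= 0 are ever used.  Elements of L^2(0, oo) are
   represented by (Borel) measurable functions, and equality in L^2(0, oo) is
   equality almost everywhere on ]0, oo[. *)

Definition cplx (R : realType) (f : R -> R) : R -> R[i] := fun x => (f x)%:C.

(* R[i] as a numFieldType, which gives access to its norm topology. *)
Definition Cfield (R : realType) : numFieldType := R[i].

Definition cmeasurable (R : realType) (A : set R) (f : R -> R[i]) : Prop :=
  measurable_fun A (fun x => complex.Re (f x)) /\
  measurable_fun A (fun x => complex.Im (f x)).

Definition cintegrable (R : realType) (A : set R) (f : R -> R[i]) : Prop :=
  lebesgue_measure.-integrable A (fun x => (complex.Re (f x))%:E) /\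
  lebesgue_measure.-integrable A (fun x => (complex.Im (f x))%:E).

Definition cint (R : realType) (A : set R) (f : R -> R[i]) : R[i] :=
  (\int[lebesgue_measure]_(x in A) complex.Re (f x)) +i*
  (\int[lebesgue_measure]_(x in A) complex.Im (f x)).

Definition aeq (R : realType) (u v : R -> R[i]) : Prop :=
  u = v %[ae lebesgue_measure in `]0, +oo[%classic].

Definition L2on (R : realType) (A : set R) : set (R -> R[i]) :=
  [set f | cmeasurable A f /\
    (\int[lebesgue_measure]_(x in A)
       ((ComplexField.Normc.normc (f x)) ^+ 2)%:E < +oo)%E].

Definition L2 (R : realType) : set (R -> R[i]) := L2on `]0, +oo[.

Definition L2loc (R : realType) : set (R -> R[i]) :=
  [set g | forall a : R, 0 < a -> L2on `]0, a[ g].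

Definition inner (R : realType) (f g : R -> R[i]) : R[i] :=
  cint `]0, +oo[ (fun x => f x * (g x)^*).

Definition L2norm (R : realType) (f : R -> R[i]) : R :=
  Num.sqrt (\int[lebesgue_measure]_(x in `]0, +oo[)
    (ComplexField.Normc.normc (f x)) ^+ 2).

Definition is_wderiv (R : realType) (f g : R -> R[i]) : Prop :=
  L2loc g /\ forall x : R, 0 <= x -> f x = f 0 + cint `[0, x] g.

Definition W (R : realType) : set (R -> R[i]) :=
  [set f | {within `[0, +oo[, continuous (f : R -> Cfield R)} /\
           exists g, is_wderiv f g].

(* A chosen weak derivative, determined a.e. for f in W. *)
Definition wderiv (R : realType) (f : R -> R[i]) : R -> R[i] :=
  xget (fun=> 0) [set g | is_wderiv f g].

Definition aeW (R : realType) : set (R -> R[i]) :=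
  [set u | exists2 h, W h & aeq u h].

(* For u in aeW this is the continuous representative of u; its values at all
   points of [0, oo), including 0, are uniquely determined. *)
Definition crep (R : realType) (u : R -> R[i]) : R -> R[i] :=
  xget u [set h | W h /\ aeq u h].

Definition kernel_op (R : realType) (K : R -> R -> R[i]) (f : R -> R[i]) :
    R -> R[i] :=
  fun x => cint `]0, +oo[ (fun y => K x y * f y).

Definition bounded_kernel (R : realType) (K : R -> R -> R[i]) : Prop :=
  exists M : R, forall f : R -> R[i], L2 f ->
    [/\ {ae lebesgue_measure, forall x : R, `]0, +oo[%classic x ->
           cintegrable `]0, +oo[ (fun y => K x y * f y)},
        L2 (kernel_op K f) &
        L2norm (kernel_op K f) <= M * L2norm f].

(* The set of elements of L^2(0, oo) having a representative in A.  Subsets of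
   L^2(0, oo) are sets of functions saturated in this sense. *)
Definition L2class (R : realType) (A : set (R -> R[i])) : set (R -> R[i]) :=
  [set g | L2 g /\ exists2 h, A h & aeq g h].

Definition green_kernel (R : realType) (xi phi : R -> R[i]) (x y : R) : R[i] :=
  if x <= y then xi x * phi y else phi x * xi y.

Definition psi (R : realType) (phi : R -> R) (x : R) : R :=
  phi x * \int[lebesgue_measure]_(s in `[0, x]) (phi s ^+ 2)^-1.

Definition G (R : realType) (phi : R -> R) : R -> R -> R[i] :=
  green_kernel (cplx (psi phi)) (cplx phi).

Definition xi (R : realType) (phi : R -> R) (gamma : R[i]) (x : R) : R[i] :=
  (psi phi x)%:C + gamma * (phi x)%:C.

Definition Gg (R : realType) (phi : R -> R) (gamma : R[i]) : R -> R -> R[i] :=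
  green_kernel (xi phi gamma) (cplx phi).

Definition Ran_Gg (R : realType) (phi : R -> R) (gamma : R[i]) :
    set (R -> R[i]) :=
  L2class (kernel_op (Gg phi gamma) @` @L2 R).

(* The inverse of the operator with kernel Gg phi gamma: H phi gamma g is a
   representative of the preimage of g, for g in Dom_H. *)
Definition Dom_H (R : realType) (phi : R -> R) (gamma : R[i]) :
    set (R -> R[i]) :=
  [set g | L2 g /\ exists2 f, L2 f & aeq (kernel_op (Gg phi gamma) f) g].

Definition H (R : realType) (phi : R -> R) (gamma : R[i]) (g : R -> R[i]) :
    R -> R[i] :=
  xget (fun=> 0) [set f | L2 f /\ aeq (kernel_op (Gg phi gamma) f) g].

(* phi g' - phi' g *)
Definition wronsk (R : realType) (phi : R -> R) (g : R -> R[i]) : R -> R[i] :=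
  fun x => (phi x)%:C * wderiv g x - wderiv (cplx phi) x * g x.

(* Clause (D2) is meaningful in view of (D3), which makes crep the continuous
   representative. *)
Definition Dg (R : realType) (phi : R -> R) (gamma : R[i]) :
    set (R -> R[i]) :=
  [set g |
    [/\ L2 g /\ W g,
        crep (wronsk phi g) 0 = g 0 / (gamma * (phi 0)%:C),
        aeW (wronsk phi g),
        L2 (fun x => ((phi x)%:C)^-1 * wderiv (crep (wronsk phi g)) x) &
        (fun x : R => g x / (psi phi x)%:C : Cfield R) @ +oo
          --> (0 : Cfield R)]].

(* Main.v *)
Require Import Defs.
From HB Require Import structures.
From mathcomp Require Import all_boot all_order all_algebra.
From mathcomp Require Import complex.
From mathcomp Require Import all_classical all_reals all_analysis.
From mathcomp Require Import measurable_realfun.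
From mathcomp Require Import ring lra.
Set Implicit Arguments.
Unset Strict Implicit.
Unset Printing Implicit Defensive.
Import Order.TTheory GRing.Theory Num.Theory.
Import numFieldNormedType.Exports.
Local Open Scope classical_set_scope.
Local Open Scope ring_scope.
Local Open Scope complex_scope.

(* Write G f and G_gamma f as phi u.  With F(x) = int_x^oo phi f, integration by
   parts gives u = gamma F(0) + int_0^x F / phi^2, so that the Wronskian
   phi g' - phi' g of g = phi u is phi^2 u' = F and (phi g' - phi' g)' = - phi f.
   Conversely, for g in D_gamma the function F := phi g' - phi' g and
   f := - F' / phi satisfy F = L + int_x^oo phi f for a constant L, and
   (g / phi)' = F / phi^2.  As int_0^x phi^-2 diverges (AM-GM and phi in L^2),
   g / psi tends to L, so the decay condition forces L = 0 and g = G_gamma f.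
   For the quadratic form, boundedness of G applied to |f| and Tonelli give
   int (F / phi)^2 <= <|f|, G |f|> < oo, which justifies Fubini in
   <f1, phi u2>. *)

(** * Fubini on a triangle *)

(** Weak derivatives are only locally square integrable, so nothing is differentiated pointwise: a
    derivative is read through its integral, and integration by parts is itself an exchange of
    integrals over the triangle s < x. The same exchange on unbounded ranges gives the quadratic
    form, where absolute integrability is the obstacle. For f >= 0 Tonelli needs none, which is why
    G is applied to |f|; the mixed terms are then products of two square integrable functions F /
    phi. In the converse no quotient rule is used for g / phi: the difference d = g - phi u solves
    d' = (phi' / phi) d with d(0) = 0, and such a d vanishes. The constant L exists because phi f, a
    product of two square integrable functions, is integrable up to infinity. The parameter gamma
    adds the rank one kernel gamma phi(x) phi(y). It accounts for the constant gamma F(0) in u and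
    for the boundary term of the form. Since phi and G are real, real and imaginary parts are
    coupled only through that constant, and the analysis is done on real functions. *)

Section triangle.
Context {R : realType}.
Notation mu := (@lebesgue_measure R).
Variables a b : R -> R.
Hypotheses (ma : measurable_fun setT a) (mb : measurable_fun setT b).

Let f (z : R * R) : \bar R := (if z.1 < z.2 then a z.1 * b z.2 else 0)%:E.

Let mf : measurable_fun setT f.
Proof.
apply/measurable_EFinP; apply: measurable_fun_ifT => //.
  by apply: measurable_fun_ltr.
by apply: measurable_funM; apply: measurableT_comp.
Qed.

Let f1 s : (fun x => f (s, x)) = (fun x => ((a s)%:E * ((EFin \o b) \_ `]s, +oo[) x)%E).
Proof.
apply/funext => x; rewrite /f /= patchE mem_setE in_itv/= andbT.
by case: ifPn => _; rewrite ?mule0.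
Qed.

Let f2 x : (fun s => f (s, x)) = (fun s => ((b x)%:E * ((EFin \o a) \_ `]-oo, x[) s)%E).
Proof.
apply/funext => s; rewrite /f /= patchE mem_setE in_itv/=.
by case: ifPn => _; rewrite ?mule0// EFinM muleC.
Qed.

Lemma triangle_tonelli : (forall x, 0 <= a x) -> (forall x, 0 <= b x) ->
  (\int[mu]_s ((a s)%:E * \int[mu]_(x in `]s, +oo[) (b x)%:E) =
   \int[mu]_x ((b x)%:E * \int[mu]_(s in `]-oo, x[) (a s)%:E))%E.
Proof.
move=> a0 b0.
have f0 z : (0 <= f z)%E by rewrite /f lee_fin; case: ifP => // _; rewrite mulr_ge0.
transitivity (\int[mu]_s \int[mu]_x f (s, x))%E.
  apply: eq_integral => s _; rewrite f1 ge0_integralZl_EFin//.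
  - by rewrite -integral_mkcond.
  - by move=> x _; rewrite patchE; case: ifP => // _; rewrite lee_fin.
  - apply/(measurable_restrictT _ _).1 => //.
    by apply: measurable_funTS; apply/measurable_EFinP.
rewrite (fubini_tonelli (m1 := mu) (m2 := mu) f mf f0).
apply: eq_integral => x _; rewrite f2 ge0_integralZl_EFin//.
- by rewrite -integral_mkcond.
- by move=> s _; rewrite patchE; case: ifP => // _; rewrite lee_fin.
- apply/(measurable_restrictT _ _).1 => //.
  by apply: measurable_funTS; apply/measurable_EFinP.
Qed.

Hypothesis ia : forall x, mu.-integrable `]-oo, x[ (EFin \o a).
Hypothesis ib : forall x, mu.-integrable `]x, +oo[ (EFin \o b).
Hypothesis iab :
  (\int[mu]_s (`|a s|%:E * \int[mu]_(x in `]s, +oo[) `|b x|%:E) < +oo)%E.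

Let fF s : (\int[mu]_x f (s, x) = (a s * \int[mu]_(x in `]s, +oo[) b x)%:E)%E.
Proof.
rewrite f1 integralZl//; last by apply/(integrable_mkcond _ _).1.
by rewrite -integral_mkcond /= EFinM /Rintegral fineK//; apply: integrable_fin_num.
Qed.

Let fG x : (\int[mu]_s f (s, x) = (b x * \int[mu]_(s in `]-oo, x[) a s)%:E)%E.
Proof.
rewrite f2 integralZl//; last by apply/(integrable_mkcond _ _).1.
by rewrite -integral_mkcond /= EFinM /Rintegral fineK//; apply: integrable_fin_num.
Qed.

Let imf : (mu \x mu)%E.-integrable setT f.
Proof.
apply: (integrable12ltyP mu mu mf).2; apply: le_lt_trans iab.
rewrite le_eqVlt; apply/orP; left; apply/eqP.
apply: eq_integral => s _.
transitivity (\int[mu]_x (`|a s|%:E * ((EFin \o (Num.norm \o b)) \_ `]s, +oo[) x))%E.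
  apply: eq_integral => x _.
  rewrite -[f (s, x)]/((fun x => f (s, x)) x) f1 abseM /=.
  by congr (_ * _)%E; rewrite !patchE; case: ifP => // _; rewrite abse0.
rewrite ge0_integralZl_EFin//.
- by rewrite -integral_mkcond.
- by move=> x _; rewrite patchE; case: ifP => // _; rewrite lee_fin /=.
- apply/(measurable_restrictT _ _).1 => //.
  by apply: measurable_funTS; apply/measurable_EFinP; apply: measurableT_comp.
Qed.

(** The bound [iab] on absolute values makes [f] integrable on the plane. The hypotheses [ia] and
    [ib] keep the inner integrals finite: real-valued integrals pass through [fine], which sends
    infinite values to 0. *)
Lemma triangle_fubini :
  [/\ mu.-integrable setT (EFin \o (fun s => a s * \int[mu]_(x in `]s, +oo[) b x)),
      mu.-integrable setT (EFin \o (fun x => b x * \int[mu]_(s in `]-oo, x[) a s)) &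
   \int[mu]_s (a s * \int[mu]_(x in `]s, +oo[) b x) =
   \int[mu]_x (b x * \int[mu]_(s in `]-oo, x[) a s)].
Proof.
have EF : fubini_F mu f = EFin \o (fun s => a s * \int[mu]_(x in `]s, +oo[) b x).
  by apply/funext => s; rewrite /fubini_F fF.
have EG : fubini_G mu f = EFin \o (fun x => b x * \int[mu]_(s in `]-oo, x[) a s).
  by apply/funext => s; rewrite /fubini_G fG.
split.
- by rewrite -EF; apply: integrable_fubini_F.
- rewrite -EG; apply/integrableP; split; first exact: (measurable_fubini_G imf).
  apply: le_lt_trans ((integrable21ltyP mu mu mf).1 imf).
  apply: ge0_le_integral => //.
  + by apply: measurableT_comp => //; exact: (measurable_fubini_G imf).
  + apply: (measurable_fun_fubini_tonelli_G (m1 := mu) (abse \o f)) => //=.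
    exact: measurableT_comp.
  + move=> x _; apply: le_abse_integral => //.
    exact: (measurableT_comp mf).
- congr fine; have := Fubini imf.
  by under [in LHS]eq_integral do rewrite fF;
     under [in RHS]eq_integral do rewrite fG.
Qed.

End triangle.

Lemma measurable_tail_integral {R : realType} (b : R -> R) :
  measurable_fun setT b -> (forall x, 0 <= b x) ->
  measurable_fun setT
    (fun s : R => \int[@lebesgue_measure R]_(x in `]s, +oo[) (b x)%:E)%E.
Proof.
move=> mb b0.
pose f (z : R * R) : \bar R := (if z.1 < z.2 then b z.2 else 0)%:E.
have mf : measurable_fun setT f.
  apply/measurable_EFinP; apply: measurable_fun_ifT => //.
    by apply: measurable_fun_ltr.
  exact: measurableT_comp.
have f0 z : (0 <= f z)%E by rewrite /f lee_fin; case: ifP.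
have := measurable_fun_fubini_tonelli_F (m2 := @lebesgue_measure R) f mf f0.
congr measurable_fun; apply/funext => s; rewrite /fubini_F [RHS]integral_mkcond.
apply: eq_integral => x _; rewrite patchE mem_setE in_itv/= andbT /f /=.
by case: ifP.
Qed.

(** * Primitives of locally integrable functions *)

Section primitive.
Context {R : realType}.
Notation mu := (@lebesgue_measure R).
Implicit Types (f g h : R -> R) (a x : R).

(** A negative [a] gives an empty interval, so no sign condition is imposed. *)
Definition locint g := forall a, mu.-integrable `[0, a] (EFin \o g).

(** Local absolute continuity on the half line with density [g]. Only local integrability is asked
    of [g]; the local square integrability contained in [is_wderiv] is tracked separately by
    [L2rloc]. *)
Definition primitive f g :=
  locint g /\ forall x, 0 <= x -> f x = f 0 + \int[mu]_(t in `[0, x]) g t.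

Lemma locintS g (A : set R) a : locint g -> measurable A -> A `<=` `[0, a] ->
  mu.-integrable A (EFin \o g).
Proof. by move=> lg mA Aa; apply: integrableS (lg a). Qed.

Lemma itv0y_bigcup : `[0, +oo[%classic = \bigcup_k `[0, k%:R]%classic :> set R.
Proof.
apply/seteqP; split => [x/=|x [k _]] /=; rewrite !in_itv/= ?andbT.
  move=> x0; exists (Num.truncn x).+1 => //=.
  by rewrite in_itv/= x0/= ltW// truncnS_gt.
by move=> /andP[].
Qed.

Lemma locint_measurable g : locint g -> measurable_fun `[(0 : R), +oo[ g.
Proof.
move=> lg; rewrite itv0y_bigcup; apply/measurable_fun_bigcup => // k.
by have /measurable_int/measurable_EFinP := lg k%:R.
Qed.

Lemma locintD g h : locint g -> locint h -> locint (fun x => g x + h x).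
Proof.
move=> lg lh a; have := integrableD _ (lg a) (lh a).
by move=> /(_ (measurable_itv _)); apply: eq_integrable.
Qed.

Lemma locintZ c g : locint g -> locint (fun x => c * g x).
Proof.
move=> lg a; have := integrableZl _ c (lg a).
by move=> /(_ (measurable_itv _)); apply: eq_integrable.
Qed.

Lemma locintN g : locint g -> locint (fun x => - g x).
Proof.
by move=> /(locintZ (-1)) lg a; apply: eq_integrable (lg a) => //= x _; rewrite mulN1r.
Qed.

Lemma locintB g h : locint g -> locint h -> locint (fun x => g x - h x).
Proof. by move=> lg lh; apply: locintD => //; exact: locintN. Qed.

Lemma locint_norm g : locint g -> locint (fun x => `|g x|).
Proof. by move=> lg a; apply: integrable_norm (lg a). Qed.

Lemma locint_eq g h : (forall x, 0 <= x -> g x = h x) -> locint g -> locint h.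
Proof.
move=> gh lg a; apply: eq_integrable (lg a) => //= x.
by rewrite inE/= in_itv/= => /andP[x0 _]; rewrite gh.
Qed.

Lemma primitive_sub f g s x : primitive f g -> 0 <= s -> s <= x ->
  \int[mu]_(t in `]s, x]) g t = f x - f s.
Proof.
move=> [lg fg] s0 sx; rewrite (fg x) ?(le_trans s0)// (fg s)//.
rewrite opprD addrACA subrr add0r Rintegral_itvB//; exact: lg.
Qed.

Lemma primitive_bound f g a : primitive f g ->
  exists M, forall x, 0 <= x <= a -> `|f x| <= M.
Proof.
move=> [lg fg]; exists (`|f 0| + \int[mu]_(t in `[0, a]) `|g t|) => x /andP[x0 xa].
rewrite fg// (le_trans (ler_normD _ _))// lerD2l.
apply: le_trans (le_normr_Rintegral _ (lg x)) _ => //.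
have la := locint_norm lg.
rewrite -[leRHS](subrK (\int[mu]_(t in `[0, x]) `|g t|)) Rintegral_itvB ?bnd_simp//.
by rewrite lerDr Rintegral_ge0.
Qed.

Lemma primitive_continuous f g : primitive f g ->
  {within `[0, +oo[, continuous f}.
Proof.
move=> [lg fg].
have H b : 0 < b -> {within `[0, b], continuous f}.
  move=> b0; apply: (@subspace_eq_continuous _ _ _
    (fun x => f 0 + \int[mu]_(t in `[0, x]) g t)).
    by move=> x; rewrite inE/= in_itv/= => /andP[x0 _]; rewrite /from_subspace [in RHS]fg.
  move=> x; apply: cvgD; first exact: cvg_cst.
  by have := @parameterized_integral_continuous R 0 b g (ltW b0) (lg b); apply.
apply/continuous_within_itvcyP; split => [x|].
  rewrite in_itv/= andbT => x0.
  have x1 : 0 < x + 1 by rewrite addr_gt0.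
  have [+ _ _] := (continuous_within_itvP f x1).1 (H _ x1).
  by apply; rewrite in_itv/= x0 ltrDl ltr01.
by have [_ + _] := (continuous_within_itvP f ltr01).1 (H _ ltr01).
Qed.

Lemma continuous_segment f a : {within `[0, +oo[, continuous f} ->
  {within `[0, a], continuous f}.
Proof.
apply: continuous_subspaceW => x /=; by rewrite !in_itv/= => /andP[->].
Qed.

Lemma continuous_measurable f : {within `[0, +oo[, continuous f} ->
  measurable_fun `[(0 : R), +oo[ f.
Proof. by move=> cf; apply: subspace_continuous_measurable_fun. Qed.

Lemma continuous_bounded f a : {within `[0, +oo[, continuous f} ->
  exists M, forall x, 0 <= x <= a -> `|f x| <= M.
Proof.
move=> cf; have [a0|a0] := leP 0 a; last first.
  by exists 0 => x /andP[x0 /(le_trans x0)]; rewrite leNgt a0.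
have [c _ Hc] := EVT_max a0 (continuous_segment cf).
have [d _ Hd] := EVT_min a0 (continuous_segment cf).
exists (Num.max `|f c| `|f d|) => x xa.
have xi : x \in `[0, a] by rewrite in_itv.
rewrite le_max; have [fx0|fx0] := leP 0 (f x).
  by rewrite ger0_norm// (le_trans (Hc _ xi))// ler_norm.
apply/orP; right; rewrite ltr0_norm// ler0_norm ?lerN2 ?Hd//.
by rewrite (le_trans (Hd _ xi))// ltW.
Qed.

Lemma locintM f g : {within `[0, +oo[, continuous f} -> locint g ->
  locint (fun x => f x * g x).
Proof.
move=> cf lg a; have [M HM] := continuous_bounded a cf.
apply: (@le_integrable _ _ _ mu _ _ _ (EFin \o (fun x => M * g x))) => //.
- apply/measurable_EFinP; apply: measurable_funM.
    apply: measurable_funS (continuous_measurable cf) => // x/=.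
    by rewrite !in_itv/= => /andP[->].
  by have /measurable_int/measurable_EFinP := lg a.
- move=> x; rewrite /= in_itv/= => /HM fM.
  by rewrite lee_fin !normrM ler_wpM2r// (le_trans fM)// ler_norm.
- exact: locintZ.
Qed.

Lemma continuous_locint f : {within `[0, +oo[, continuous f} -> locint f.
Proof.
move=> cf a; apply: (@continuous_compact_integrable R) => //.
- exact: segment_compact.
- exact: continuous_segment.
Qed.

Lemma integrable_patch g (A : set R) : measurable A ->
  mu.-integrable A (EFin \o g) -> mu.-integrable setT (EFin \o g \_ A).
Proof.
by move=> mA iA; rewrite -restrict_EFin; apply/(integrable_mkcond _ _).1.
Qed.

Lemma locint_restrict g a : locint g -> mu.-integrable setT (EFin \o g \_ `]0, a]).
Proof.
move=> lg; apply: integrable_patch => //.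
apply: integrableS (lg a) => // x /=; rewrite !in_itv/= => /andP[x0 ->].
by rewrite ltW.
Qed.

End primitive.

(** * Rules for primitives: linearity, changes on null sets, products *)

Section calculus.
Context {R : realType}.
Notation mu := (@lebesgue_measure R).
Implicit Types (f g h : R -> R) (a x : R).

Lemma ae_mono (P Q : R -> Prop) : (forall x, P x -> Q x) ->
  (\forall x \ae mu, P x) -> \forall x \ae mu, Q x.
Proof. by apply: filterS; exact: (ae_filter_ringOfSetsType mu). Qed.

Lemma ae_mono2 (P Q S : R -> Prop) : (forall x, P x -> Q x -> S x) ->
  (\forall x \ae mu, P x) -> (\forall x \ae mu, Q x) -> \forall x \ae mu, S x.
Proof. by apply: filterS2; exact: (ae_filter_ringOfSetsType mu). Qed.

(** Almost everywhere equality is known on the open half line, whereas primitives integrate over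
    [0, x]. The endpoint 0 is a null set, so integrals are moved to ]0, x] and back. *)
Lemma primitive_ae f g h : primitive f g -> measurable_fun `[(0 : R), +oo[ h ->
  g = h %[ae mu in `]0, +oo[%classic] -> primitive f h.
Proof.
move=> [lg fg] mh gh.
have sub a : `]0, a] `<=` `[(0 : R), a]%classic by move=> x/=; rewrite !in_itv/= => /andP[/ltW -> ->].
have gh0 a : ae_eq mu `]0%R, a]%classic (EFin \o g) (EFin \o h).
  move: gh; apply: ae_mono => x gh /=; rewrite in_itv/= => /andP[x0 _].
  by rewrite gh//= in_itv/= x0.
have mg a : measurable_fun `]0%R, a]%classic (EFin \o g).
  by apply: measurable_funS (measurable_int mu (lg a)).
have mh0 a : measurable_fun `[0%R, a]%classic (EFin \o h).
  apply/measurable_EFinP; apply: measurable_funS mh => // x/=.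
  by rewrite !in_itv/= => /andP[->].
have mh1 a : measurable_fun `]0%R, a]%classic (EFin \o h).
  by apply: measurable_funS (mh0 a).
split => [a|x x0].
  apply/integrableP; split; first exact: mh0.
  have E1 : (\int[mu]_(x in `]0%R, a]) `|(h x)%:E| = \int[mu]_(x in `]0%R, a]) `|(g x)%:E|)%E.
    apply: (@ae_eq_integral _ _ _ mu _ (abse \o (EFin \o g)) (abse \o (EFin \o h))) => //.
    - by apply: measurableT_comp => //; exact: mh1.
    - by apply: measurableT_comp => //; exact: mg.
    - by apply: ae_eq_abse; apply: ae_eq_sym.
  apply: (@le_lt_trans _ _ (\int[mu]_(x in `]0%R, a]) `|(h x)%:E|)%E).
    rewrite integral_itv_obnd_cbnd//; apply: (@measurableT_comp _ _ _ _ _ _ abse) => //; exact: mh1.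
  rewrite E1; have [_] := integrableP _ _ _ (lg a); apply: le_lt_trans.
  rewrite integral_itv_obnd_cbnd//; apply: (@measurableT_comp _ _ _ _ _ _ abse) => //; exact: mg.
rewrite fg//; congr (_ + fine _).
transitivity (\int[mu]_(x in `]0%R, x]) (g x)%:E)%E.
  by rewrite integral_itv_obnd_cbnd//; exact: mg.
transitivity (\int[mu]_(x in `]0%R, x]) (h x)%:E)%E; last first.
  by rewrite integral_itv_obnd_cbnd//; exact: mh1.
by apply: ae_eq_integral => //; [exact: mg|exact: mh1].
Qed.

Lemma eq_primitive f1 f2 g : (forall x, 0 <= x -> f1 x = f2 x) ->
  primitive f1 g -> primitive f2 g.
Proof. by move=> f12 [lg fg]; split=> // x x0; rewrite -!f12// fg. Qed.

Lemma eq_primitive_deriv f g1 g2 : (forall x, 0 <= x -> g1 x = g2 x) ->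
  primitive f g1 -> primitive f g2.
Proof.
move=> g12 [lg fg]; split=> [|x x0]; first exact: locint_eq lg.
rewrite fg//; congr (_ + _); apply: eq_Rintegral => t.
by rewrite inE/= in_itv/= => /andP[t0 _]; rewrite g12.
Qed.

Lemma primitiveD f1 f2 g1 g2 : primitive f1 g1 -> primitive f2 g2 ->
  primitive (fun x => f1 x + f2 x) (fun x => g1 x + g2 x).
Proof.
move=> [lg1 fg1] [lg2 fg2]; split=> [|x x0]; first exact: locintD.
by rewrite fg1// fg2// RintegralD//; ring.
Qed.

Lemma primitiveZ c f g : primitive f g ->
  primitive (fun x => c * f x) (fun x => c * g x).
Proof.
move=> [lg fg]; split=> [|x x0]; first exact: locintZ.
by rewrite fg// RintegralZl//; ring.
Qed.

Lemma primitiveB f1 f2 g1 g2 : primitive f1 g1 -> primitive f2 g2 ->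
  primitive (fun x => f1 x - f2 x) (fun x => g1 x - g2 x).
Proof.
move=> p1 /(primitiveZ (-1)) /(primitiveD p1) p.
apply: (eq_primitive (f1 := fun x => f1 x + -1 * f2 x)).
  by move=> x x0; rewrite mulN1r.
by apply: eq_primitive_deriv p => x x0; rewrite mulN1r.
Qed.

Lemma primitive_cst c : primitive (fun=> c) (fun=> 0 : R).
Proof.
split=> [a|x _]; first exact: (integrable0 mu).
by rewrite Rintegral_cst// mul0r addr0.
Qed.

Lemma primitive_int g c : locint g ->
  primitive (fun x => c + \int[mu]_(t in `[0, x]) g t) g.
Proof. by move=> lg; split=> // x x0; rewrite set_itv1 Rintegral_set1 addr0. Qed.

(** Fubini on the triangle, for [g1] and [g2] cut off to ]0, x], reads: the integral of g1(s) (f2(x)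
    - f2(s)) equals that of g2(y) (f1(y) - f1(0)). Rearranged, this is the product rule, valid for
    merely integrable densities. *)
Lemma primitiveM f1 f2 g1 g2 : primitive f1 g1 -> primitive f2 g2 ->
  primitive (fun x => f1 x * f2 x) (fun x => f1 x * g2 x + f2 x * g1 x).
Proof.
move=> p1 p2.
have l1 : locint (fun x => f1 x * g2 x).
  by apply: locintM; [exact: primitive_continuous p1|case: p2].
have l2 : locint (fun x => f2 x * g1 x).
  by apply: locintM; [exact: primitive_continuous p2|case: p1].
split=> [|x x0]; first exact: locintD.
rewrite RintegralD//.
pose a : R -> R := g1 \_ `]0, x]; pose b : R -> R := g2 \_ `]0, x].
have ia : mu.-integrable setT (EFin \o a) by apply: locint_restrict; case: p1.
have ib : mu.-integrable setT (EFin \o b) by apply: locint_restrict; case: p2.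
have ma : measurable_fun setT a by apply/measurable_EFinP; exact: measurable_int ia.
have mb : measurable_fun setT b by apply/measurable_EFinP; exact: measurable_int ib.
have iab : (\int[mu]_s (`|a s|%:E * \int[mu]_(x in `]s, +oo[) `|b x|%:E) < +oo)%E.
  have mnb : measurable_fun setT (fun x => `|b x|) by exact: measurableT_comp.
  apply: (@le_lt_trans _ _ (\int[mu]_s (`|a s|%:E * \int[mu]_x `|b x|%:E))%E).
    apply: ge0_le_integral => //.
    - by move=> s _; rewrite mule_ge0// integral_ge0.
    - apply: emeasurable_funM; first by apply/measurable_EFinP; exact: measurableT_comp.
      exact: measurable_tail_integral.
    - apply: emeasurable_funM; first by apply/measurable_EFinP; exact: measurableT_comp.
      exact: measurable_cst.
    - move=> s _; rewrite lee_wpmul2l//; apply: ge0_subset_integral => //.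
      exact/measurable_EFinP.
  have [_ iboo] := integrableP _ _ _ ib.
  have [_ iaoo] := integrableP _ _ _ ia.
  rewrite ge0_integralZr//; [|by apply/measurable_EFinP; exact: measurableT_comp|exact: integral_ge0].
  by rewrite lte_mul_pinfty// ?integral_ge0// ge0_fin_numE ?integral_ge0.
have [] := triangle_fubini ma mb _ _ iab.
- by move=> y; apply: integrableS ia.
- by move=> y; apply: integrableS ib.
move=> _ _.
have aE (s : R) : a s * \int[mu]_(y in `]s, +oo[) b y =
    ((fun s => f2 x * g1 s - f2 s * g1 s) \_ `]0, x]) s.
  rewrite /a !patchE; case: ifPn => [|_]; last by rewrite mul0r.
  rewrite inE/= in_itv/= => /andP[s0 sx].
  rewrite /b -Rintegral_mkcondr.
  rewrite (_ : `]s, +oo[ `&` `]0, x] = `]s, x]%classic); last first.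
    apply/seteqP; split=> y /=; rewrite !in_itv/= ?andbT.
      by move=> [-> /andP[_ ->]].
    by move=> /andP[sy yx]; rewrite sy yx (lt_trans s0 sy).
  by rewrite (primitive_sub p2) ?(ltW s0)//; ring.
have bE (y : R) : b y * \int[mu]_(s in `]-oo, y[) a s =
    ((fun y => f1 y * g2 y - f1 0 * g2 y) \_ `]0, x]) y.
  rewrite /b !patchE; case: ifPn => [|_]; last by rewrite mul0r.
  rewrite inE/= in_itv/= => /andP[y0 yx].
  rewrite /a -Rintegral_mkcondr.
  rewrite (_ : `]-oo, y[ `&` `]0, x] = `]0, y[%classic); last first.
    apply/seteqP; split=> s /=; rewrite !in_itv/=.
      by move=> [-> /andP[->]].
    by move=> /andP[-> sy]; rewrite sy (le_trans (ltW sy) yx).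
  rewrite Rintegral_itv_bndo_bndc//.
    by rewrite (primitive_sub p1) ?(ltW y0)//; ring.
  apply: (@locintS _ _ _ y) => //; first by case: p1.
  by move=> t/=; rewrite !in_itv/= => /andP[/ltW -> /ltW].
under eq_Rintegral do rewrite aE.
under [in RHS]eq_Rintegral do rewrite bE.
rewrite -!Rintegral_mkcond.
have lx h : locint h -> mu.-integrable `]0, x] (EFin \o h).
  move=> lh; apply: (@locintS _ _ _ x) => // t/=.
  by rewrite !in_itv/= => /andP[/ltW -> ->].
have ox h : locint h -> \int[mu]_(t in `]0, x]) h t = \int[mu]_(t in `[0, x]) h t.
  by move=> lh; rewrite Rintegral_itv_obnd_cbnd//; exact: lx.
have lg1 : locint g1 by case: p1.
have lg2 : locint g2 by case: p2.
rewrite !RintegralB//; do ?by apply: lx => //; exact: locintZ.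
rewrite !RintegralZl//; do ?by apply: lx => //.
rewrite !(primitive_sub p1, primitive_sub p2)// ox// ox//.
lra.
Qed.

End calculus.

(** * Almost everywhere uniqueness of densities, and a linear differential equation *)

Section uniqueness.
Context {R : realType}.
Notation mu := (@lebesgue_measure R).
Implicit Types (f g h : R -> R) (a x : R).

(** Lebesgue differentiation: the indefinite integral of [g] is identically 0, so its derivative 0
    equals [g] almost everywhere. The theorem is applied on the whole line to [g] cut off to [0, n],
    and the null sets are united over n. *)
Lemma primitive_cst_ae0 f g : primitive f g -> (forall x, 0 <= x -> f x = f 0) ->
  g = (fun=> 0) %[ae mu in `]0, +oo[%classic].
Proof.
move=> [lg fg] f0.
have I0 x : \int[mu]_(t in `[0, x]) g t = 0.
  have [x0|x0] := leP 0 x; first by apply: (addrI (f 0)); rewrite -fg// f0// addr0.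
  by rewrite set_itv_ge ?Rintegral_set0// bnd_simp -ltNge.
pose A n := `[0, n%:R]%classic : set R.
have mA n : measurable (A n) by exact: measurable_itv.
have H n : {ae mu, forall x, 0 < x -> (g \_ (A n)) x = 0}.
  have li : locally_integrable [set: R] (g \_ (A n)).
    by apply: integrable_locally => //; exact: (lg n%:R).
  have lf y : mu.-integrable [set` Interval (BLeft 0) (BRight y)] (EFin \o (g \_ (A n))).
    have : mu.-integrable setT (EFin \o (g \_ (A n))).
      by apply: integrable_patch; [exact: mA|exact: (lg n%:R)].
    by apply: integrableS.
  have := FTC1 lf li.
  rewrite (_ : (fun x => _) = cst 0); last first.
    apply/funext => x /=; rewrite -Rintegral_mkcondr.
    rewrite (_ : _ `&` _ = `[0, Num.min x n%:R]%classic) ?I0//.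
    apply/seteqP; split=> y; rewrite /A /= !in_itv/= le_min.
      by move=> [/andP[-> ->] /andP[_ ->]].
    by move=> /and3P[-> -> ->].
  apply: ae_mono => x Hx x0; have [|_ <-] := Hx; first by rewrite ?bnd_simp ?ltW//.
  by rewrite derive1_cst.
have := ae_foralln (mu := mu) H.
apply: ae_mono => x Hx /=; rewrite in_itv/= andbT => x0.
have := Hx (Num.truncn x).+1 x0; rewrite patchE; case: ifPn => //.
by rewrite notin_setE /A/= in_itv/= (ltW x0)/= ltW// truncnS_gt.
Qed.

Lemma primitive_unique f g h : primitive f g -> primitive f h ->
  g = h %[ae mu in `]0, +oo[%classic].
Proof.
move=> fg fh; have := primitive_cst_ae0 (primitiveB fg fh).
move=> /(_ _)/(ae_mono _); apply => [x H /H/eqP|x x0]; rewrite ?subr_eq0 ?subrr//.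
by move=> /eqP.
Qed.

Lemma primitive_expn P k n : primitive P k ->
  primitive (fun x => P x ^+ n.+1) (fun x => n.+1%:R * P x ^+ n * k x).
Proof.
move=> Pk; elim: n => [|n IH].
  apply: (eq_primitive (f1 := P)); first by move=> x _; rewrite expr1.
  by apply: eq_primitive_deriv Pk => x _; rewrite expr0 !mul1r.
apply: (eq_primitive (f1 := fun x => P x * P x ^+ n.+1)); first by move=> x _; rewrite -exprS.
apply: eq_primitive_deriv (primitiveM Pk IH) => x _.
by rewrite -(@natr1 _ n.+1) exprS; ring.
Qed.

(* Iterating |d| <= int_0^x |k| |d| gives |d| <= M P^n / n! with P = int |k|. *)
Lemma linear_ode_unique d k : locint k -> primitive d (fun x => k x * d x) ->
  d 0 = 0 -> forall x, 0 <= x -> d x = 0.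
Proof.
move=> lk pd d0 a a0.
have [M HM] := primitive_bound a pd.
pose P x := 0 + \int[mu]_(t in `[0, x]) `|k t|.
have lnk := locint_norm lk.
have pP : primitive P (fun x => `|k x|) by exact: primitive_int.
have P0 x : 0 <= P x by rewrite /P add0r Rintegral_ge0.
have P00 : P 0 = 0 by rewrite /P set_itv1 Rintegral_set1 addr0.
have H n x : 0 <= x <= a -> `|d x| <= M * (P x ^+ n / n`!%:R).
  elim: n x => [x xa|n IH x /andP[x0 xa]]; first by rewrite expr0 fact0 divr1 mulr1 HM.
  have [ldk dE] := pd.
  rewrite dE// d0 add0r; apply: le_trans (le_normr_Rintegral _ (ldk x)) _ => //.
  have [lPn PnE] := primitiveZ (M / n.+1`!%:R) (primitive_expn n pP).
  have -> : M * (P x ^+ n.+1 / n.+1`!%:R) =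
      \int[mu]_(t in `[0, x]) (M / n.+1`!%:R * (n.+1%:R * P t ^+ n * `|k t|)).
    by have := PnE _ x0; rewrite P00 expr0n mulr0 add0r => <-; ring.
  apply: le_Rintegral => //; first exact: (locint_norm ldk).
  move=> t /=; rewrite in_itv/= => /andP[t0 tx].
  rewrite normrM.
  have -> : M / n.+1`!%:R * (n.+1%:R * P t ^+ n * `|k t|) =
      `|k t| * (M * (P t ^+ n / n`!%:R)).
    rewrite factS natrM; field.
    by rewrite nat1r !pnatr_eq0 -lt0n fact_gt0.
  by rewrite ler_wpM2l// IH// t0 (le_trans tx).
(* The bound at [a] is [M] times the n-th term of the exponential series at [P a]. *)
have cv : (fun n => M * (P a ^+ n / n`!%:R)) @ \oo --> (0 : R).
  rewrite -[X in _ --> X](mulr0 M); apply: cvgMr.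
  exact: (cvg_series_cvg_0 (is_cvg_series_exp_coeff (P a))).
apply/eqP; rewrite -normr_le0.
rewrite -(cvg_lim _ cv)//; apply: limr_ge; first by apply/cvg_ex; exists 0.
by apply: nearW => n; apply: H; rewrite a0 lexx.
Qed.

End uniqueness.

(** * Square integrable functions on the half line *)

Section halfline.
Context {R : realType}.
Notation mu := (@lebesgue_measure R).
Notation D := (`](0 : R), +oo[%classic).
Implicit Types (f g h : R -> R) (a x : R).

Lemma integrable_cbnd h (b : itv_bound R) :
  mu.-integrable [set` Interval (BRight 0) b] (EFin \o h) ->
  mu.-integrable [set` Interval (BLeft 0) b] (EFin \o h).
Proof.
move=> /integrableP[/measurable_EFinP mh ih]; apply/integrableP; split.
  by apply/measurable_EFinP/measurable_fun_itv_obnd_cbndP.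
move: ih; rewrite integral_itv_obnd_cbnd//.
by apply: (@measurableT_comp _ _ _ _ _ _ abse) => //; apply/measurable_EFinP.
Qed.

Lemma integrable_locint h : mu.-integrable D (EFin \o h) -> locint h.
Proof.
move=> /integrable_cbnd ih a; apply: integrableS ih => //.
by move=> x/=; rewrite !in_itv/= => /andP[->].
Qed.

Lemma tail_integralE h x : mu.-integrable D (EFin \o h) -> 0 <= x ->
  \int[mu]_(t in `]x, +oo[) h t =
  \int[mu]_(t in D) h t - \int[mu]_(t in `[0, x]) h t.
Proof.
move=> ih x0; rewrite (Rintegral_itv_obnd_cbnd ih).
by rewrite Rintegral_itvB ?bnd_simp//; exact: integrable_cbnd.
Qed.

(** Monotone exhaustion: some [0, n + 1] carries all but [e] of the integral of |h|. Extending |h|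
    by 0 outside the half line makes it measurable and integrable on every interval. *)
Lemma tail_integral_small h e : mu.-integrable D (EFin \o h) -> 0 < e ->
  exists2 N, 0 <= N & forall x, N <= x -> `|\int[mu]_(t in `]x, +oo[) h t| <= e.
Proof.
move=> ih e0; pose f := (fun x => `|h x|) \_ D.
have inh : mu.-integrable D (EFin \o (fun x => `|h x|)) by exact: integrable_norm ih.
have iffT : mu.-integrable setT (EFin \o f) by exact: integrable_patch.
have ifS A : measurable A -> mu.-integrable A (EFin \o f).
  by move=> mA; apply: integrableS iffT.
have f0 x : 0 <= f x by rewrite /f patchE; case: ifP.
have mf : measurable_fun setT f by apply/measurable_EFinP; exact: measurable_int iffT.
have fin : (\int[mu]_(x in `[0%R, +oo[) (f x)%:E)%E \is a fin_num.
  by apply: integrable_fin_num => //; exact: ifS.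
have := fin; rewrite ge0_integral_ereal_sup//.
move=> /(ub_ereal_sup_adherent e0)[_ [n _ <-]].
rewrite -ge0_integral_ereal_sup// => Hn.
have {}Hn : \int[mu]_(x in `[0, +oo[) f x - e < \int[mu]_(x in `[0, n.+1%:R]) f x.
  rewrite -lte_fin EFinB /Rintegral !fineK//.
  by apply: integrable_fin_num => //; exact: ifS.
exists n.+1%:R => // x nx.
have x0 : 0 <= x by exact: le_trans nx.
have ihx : mu.-integrable `]x, +oo[ (EFin \o h).
  apply: integrableS ih => // t/=; rewrite !in_itv/= !andbT.
  exact: le_lt_trans.
apply: le_trans (le_normr_Rintegral _ ihx) _ => //.
have -> : \int[mu]_(t in `]x, +oo[) `|h t| = \int[mu]_(t in `]x, +oo[) f t.
  apply: eq_Rintegral => t; rewrite inE/= in_itv/= andbT => xt.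
  by rewrite /f patchE ifT// inE/= in_itv/= andbT (le_lt_trans x0).
have iy b : mu.-integrable [set` Interval (BLeft 0) b] (EFin \o f) by exact: ifS.
have := Rintegral_itvB (iy +oo%O) (x := x).
rewrite !bnd_simp => /(_ x0 isT) <-.
rewrite lerBlDr -lerBlDl (le_trans (ltW Hn))// -subr_ge0.
by rewrite Rintegral_itvB ?bnd_simp// Rintegral_ge0.
Qed.

Definition L2r (A : set (measurableTypeR R)) f := measurable_fun A f /\
  (\int[mu]_(x in A) ((f x) ^+ 2)%:E < +oo)%E.

Lemma L2r_sqr (A : set (measurableTypeR R)) f : measurable A -> L2r A f ->
  mu.-integrable A (EFin \o (fun x => f x ^+ 2)).
Proof.
move=> mA [mf f2]; apply/integrableP; split.
  by apply/measurable_EFinP; exact: measurable_funX.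
move: f2; congr (_ < _)%E; apply: eq_integral => x _.
by rewrite /= ger0_norm// sqr_ge0.
Qed.

(** Domination by f^2 + g^2; only integrability is wanted, not the Cauchy-Schwarz bound. *)
Lemma L2r_mul (A : set (measurableTypeR R)) f g : measurable A -> L2r A f -> L2r A g ->
  mu.-integrable A (EFin \o (fun x => f x * g x)).
Proof.
move=> mA Lf Lg.
have := integrableD mA (L2r_sqr mA Lf) (L2r_sqr mA Lg).
apply: le_integrable => //.
  by apply/measurable_EFinP; apply: measurable_funM; [case: Lf|case: Lg].
move=> x _; rewrite /= lee_fin [leRHS]ger0_norm ?addr_ge0 ?sqr_ge0//.
rewrite normrM -(real_normK (num_real (f x))) -(real_normK (num_real (g x))).
have := sqr_ge0 (`|f x| - `|g x|); have := sqr_ge0 (`|f x|).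
have := sqr_ge0 (`|g x|); nra.
Qed.

Lemma integrable_L2r (A : set (measurableTypeR R)) f : measurable A -> measurable_fun A f ->
  mu.-integrable A (EFin \o (fun x => f x ^+ 2)) -> L2r A f.
Proof.
move=> mA mf /integrableP[_ f2]; split=> //.
move: f2; congr (_ < _)%E; apply: eq_integral => x _.
by rewrite /= ger0_norm// sqr_ge0.
Qed.

Lemma L2r_le (A : set (measurableTypeR R)) f g : measurable A -> measurable_fun A f -> L2r A g ->
  (forall x, A x -> `|f x| <= `|g x|) -> L2r A f.
Proof.
move=> mA mf Lg fg; apply: integrable_L2r => //.
apply: le_integrable (L2r_sqr mA Lg) => //.
  by apply/measurable_EFinP; exact: measurable_funX.
move=> x Ax /=; rewrite lee_fin !normrX.
by rewrite lerXn2r ?nnegrE// fg.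
Qed.

Lemma L2r_norm (A : set (measurableTypeR R)) f : measurable A -> L2r A f -> L2r A (fun x => `|f x|).
Proof.
move=> mA Lf; apply: (L2r_le mA _ Lf); first by apply: measurableT_comp => //; case: Lf.
by move=> x _; rewrite normr_id.
Qed.

Lemma L2rZ (A : set (measurableTypeR R)) f c : measurable A -> L2r A f -> L2r A (fun x => c * f x).
Proof.
move=> mA Lf; apply: integrable_L2r => //.
  by apply: measurable_funM => //; case: Lf.
have := integrableZl mA (c ^+ 2) (L2r_sqr mA Lf).
by apply: eq_integrable => // x _ /=; rewrite -EFinM exprMn.
Qed.

Lemma L2rD (A : set (measurableTypeR R)) f g : measurable A -> L2r A f -> L2r A g ->
  L2r A (fun x => f x + g x).
Proof.
move=> mA Lf Lg; apply: integrable_L2r => //.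
  by apply: measurable_funD; [case: Lf|case: Lg].
have := integrableD mA (integrableD mA (L2r_sqr mA Lf) (L2r_sqr mA Lg))
  (integrableZl mA 2 (L2r_mul mA Lf Lg)).
by apply: eq_integrable => // x _ /=; rewrite -EFinM -!EFinD; congr EFin; ring.
Qed.

Lemma L2r_ae f g : measurable_fun D g -> L2r D f ->
  f = g %[ae mu in D] -> L2r D g.
Proof.
move=> mg [mf f2] fg; split=> //.
rewrite (_ : (\int[mu]_(x in D) _)%E = (\int[mu]_(x in D) (f x ^+ 2)%:E)%E)//.
apply: ae_eq_integral => //.
- by apply/measurable_EFinP; exact: measurable_funX.
- by apply/measurable_EFinP; exact: measurable_funX.
- by move: fg; apply: ae_mono => x fg Dx; rewrite fg.
Qed.

Definition L2rloc f := forall a, 0 < a -> L2r `]0, a[%classic f.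

Lemma L2rloc_cc f : L2rloc f -> forall a, L2r `[0, a]%classic f.
Proof.
move=> Lf a.
have Lb b : 0 < b -> L2r `[0, b]%classic f.
  move=> b0; have [mf f2] := Lf _ b0.
  have mf1 : measurable_fun `[0, b]%classic f by exact: measurable_fun_itv_cc mf.
  have mfs (i : interval R) : [set` i] `<=` `[0, b] ->
      measurable_fun [set` i] (fun x => ((f x) ^+ 2)%:E).
    move=> ib; apply/measurable_EFinP; apply: measurable_funX.
    exact: measurable_funS ib mf1.
  split=> //.
  rewrite -integral_itv_obnd_cbnd//; last first.
    by apply: mfs => x/=; rewrite !in_itv/= => /andP[/ltW -> ->].
  rewrite -integral_itv_bndo_bndc//.
  by apply: mfs => x/=; rewrite !in_itv/= => /andP[/ltW -> /ltW ->].
(* Enlarging to [Num.max a 1] gives a positive endpoint, so that nonpositive [a] is covered too. *)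
have [mf f2] : L2r `[0, Num.max a 1]%classic f by apply: Lb; rewrite lt_max ltr01 orbT.
have sub : `[0, a] `<=` `[0, Num.max a 1]%classic.
  by move=> x/=; rewrite !in_itv/= le_max => /andP[-> ->].
split; first exact: measurable_funS mf.
apply: le_lt_trans f2; apply: ge0_subset_integral => //.
- by apply/measurable_EFinP; exact: measurable_funX.
- by move=> x _; rewrite lee_fin sqr_ge0.
Qed.

Lemma L2rloc_locint f : L2rloc f -> locint f.
Proof.
move=> Lf a; have L1 : L2r `[0, a]%classic (fun=> 1).
  split=> //; rewrite integral_cst//= lebesgue_measure_itv/=.
  by case: ifP => _; rewrite ?mule0// -EFinB -EFinM ltry.
have := L2r_mul (measurable_itv _) (L2rloc_cc Lf a) L1.
by apply: eq_integrable => // x _ /=; rewrite mulr1.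
Qed.

Lemma L2r_loc f : L2r D f -> L2rloc f.
Proof.
move=> [mf f2] a a0.
have sub : `]0, a[ `<=` D by move=> x/=; rewrite !in_itv/= => /andP[->].
split; first exact: measurable_funS mf.
apply: le_lt_trans f2; apply: ge0_subset_integral => //.
- by apply/measurable_EFinP; exact: measurable_funX.
- by move=> x _; rewrite lee_fin sqr_ge0.
Qed.

Lemma L2rlocM f g : {within `[0, +oo[, continuous f} -> L2rloc g ->
  L2rloc (fun x => f x * g x).
Proof.
move=> cf Lg a a0; have [M HM] := continuous_bounded a cf.
have mf : measurable_fun `]0, a[%classic f.
  apply: measurable_funS (continuous_measurable cf) => // x/=.
  by rewrite !in_itv/= andbT => /andP[/ltW].
apply: (L2r_le _ _ (L2rZ M _ (Lg _ a0))) => //.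
  by apply: measurable_funM => //; case: (Lg _ a0).
move=> x /=; rewrite in_itv/= => /andP[/ltW x0 /ltW xa].
rewrite !normrM ler_wpM2r// (le_trans (HM _ _)) ?ler_norm//.
by rewrite x0.
Qed.

Lemma L2rlocD f g : L2rloc f -> L2rloc g -> L2rloc (fun x => f x + g x).
Proof. by move=> Lf Lg a a0; apply: L2rD => //; [exact: Lf|exact: Lg]. Qed.

End halfline.

(** * The Green function on real functions *)

Section green.
Context {R : realType}.
Notation mu := (@lebesgue_measure R).
Notation D := (`](0 : R), +oo[%classic).
Variables phi p : R -> R.
Hypotheses (phip : primitive phi p) (phi_gt0 : forall x, 0 <= x -> 0 < phi x).
Hypothesis phiL2 : L2r D phi.
Implicit Types (f g h : R -> R) (a x : R).

(* psi phi = phi * isq_int, and phi * usol f = G f has Wronskian tailint f. *)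
Definition isq x := (phi x ^+ 2)^-1.
Definition isq_int x := \int[mu]_(t in `[0, x]) isq t.
Definition tailint f x := \int[mu]_(t in `]x, +oo[) (phi t * f t).
Definition usol f x := \int[mu]_(t in `[0, x]) (isq t * tailint f t).

Lemma isq_continuous : {within `[0, +oo[, continuous isq}.
Proof.
have /subspace_continuousP cphi := primitive_continuous phip.
apply/subspace_continuousP => x Ax.
have px : phi x != 0.
  by move: Ax; rewrite /= in_itv/= andbT => /phi_gt0; rewrite lt0r => /andP[].
apply: cvgV; first by rewrite expf_neq0.
by apply: cvgM; exact: cphi.
Qed.

Lemma isq_gt0 x : 0 <= x -> 0 < isq x.
Proof. by move=> x0; rewrite invr_gt0 exprn_gt0// phi_gt0. Qed.

Lemma primitive_isq : primitive isq_int isq.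
Proof.
split=> [|x x0]; first exact/continuous_locint/isq_continuous.
by rewrite /isq_int set_itv1 Rintegral_set1 add0r.
Qed.

Lemma isq_int0 : isq_int 0 = 0.
Proof. by rewrite /isq_int set_itv1 Rintegral_set1. Qed.

Lemma isq_int_le x y : 0 <= x -> x <= y -> isq_int x <= isq_int y.
Proof.
move=> x0 xy; rewrite -subr_ge0 -(primitive_sub primitive_isq)//.
apply: Rintegral_ge0 => t/=; rewrite in_itv/= => /andP[xt _].
by rewrite ltW// isq_gt0// (le_trans x0)// ltW.
Qed.

(* AM-GM: 2 <= phi^2 + phi^-2. *)
Lemma isq_int_ge x : 0 <= x ->
  2 * x - \int[mu]_(t in D) phi t ^+ 2 <= isq_int x.
Proof.
move=> x0; have iq := L2r_sqr (measurable_itv _) phiL2.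
have lq := integrable_locint iq.
have l2 : locint (fun=> 2 : R) by apply: continuous_locint; exact: cst_continuous.
have H : \int[mu]_(t in `[0, x]) (2 - phi t ^+ 2) <= isq_int x.
  apply: le_Rintegral => //.
  - exact: (locintB l2 lq).
  - by case: primitive_isq.
  - move=> t/=; rewrite in_itv/= => /andP[/phi_gt0 t0 _].
    have q0 : 0 < phi t ^+ 2 by rewrite exprn_gt0.
    rewrite /isq -[leRHS]mul1r -ler_pdivrMr ?invr_gt0// invrK.
    have := sqr_ge0 (phi t ^+ 2 - 1); nra.
apply: le_trans H; rewrite RintegralB//.
rewrite Rintegral_cst//= lebesgue_measure_itv/=.
have -> : fine (if (0%:E < x%:E)%E then (x%:E - 0%:E)%E else 0%E) = x.
  case: ifPn => [_|]; first by rewrite -EFinB/= subr0.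
  by rewrite lte_fin -leNgt => x0'; apply/le_anti; rewrite x0 x0'.
rewrite lerD2l lerN2 -subr_ge0 -tail_integralE// Rintegral_ge0// => t _.
exact: sqr_ge0.
Qed.

Lemma isq_int_large M : exists2 N, 0 <= N & forall x, N <= x -> M <= isq_int x.
Proof.
pose S := \int[mu]_(t in D) phi t ^+ 2.
(* The value (M + S) / 2 solves 2 x - S = M, the lower bound of [isq_int_ge]. *)
exists (Num.max 0 ((M + S) / 2)) => [|x]; first by rewrite le_max lexx.
rewrite ge_max => /andP[x0]; rewrite ler_pdivrMr// => MS.
by apply: le_trans (isq_int_ge x0); rewrite -/S; lra.
Qed.

(* An average of F with divergent total weight isq_int has the same limit. *)
Lemma ratio_limit F u L : primitive u (fun x => isq x * F x) ->
  (forall e, 0 < e -> exists2 N, 0 <= N & forall x, N <= x -> `|F x - L| <= e) ->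
  forall e, 0 < e -> exists2 N, 0 <= N &
    forall x, N <= x -> 0 < isq_int x /\ `|u x / isq_int x - L| <= e.
Proof.
move=> pu FL e e0.
have e20 : 0 < e / 2 by rewrite divr_gt0.
have [N N0 HN] := FL _ e20.
(* The density of [v] is isq (F - L), which past [N] is at most (e / 2) isq in absolute value. *)
pose v x := u x - L * isq_int x.
have pv := primitiveB pu (primitiveZ L primitive_isq).
(* Past [N'] the weight absorbs the initial error: |v N| is at most (e / 2) isq_int x. The summand 1
   makes the weight strictly positive even when v N = 0. *)
have [N' N'0 HN'] := isq_int_large (`|v N| / (e / 2) + 1).
exists (Num.max N N') => [|x]; first by rewrite le_max N0.
rewrite ge_max => /andP[Nx N'x].
have A1 : `|v N| / (e / 2) + 1 <= isq_int x by exact: HN'.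
have A0 : 0 < isq_int x by apply: lt_le_trans A1; rewrite ltr_wpDl// divr_ge0// ltW.
split=> //.
have -> : u x / isq_int x - L = v x / isq_int x.
  by rewrite /v mulrBl mulfK// gt_eqF.
rewrite normrM normfV (gtr0_norm A0) ler_pdivrMr//.
have vN : `|v N| <= e / 2 * isq_int x.
  rewrite mulrC -ler_pdivrMr//; apply: le_trans A1; by rewrite lerDl.
suff vx : `|v x - v N| <= e / 2 * isq_int x.
  have -> : v x = v N + (v x - v N) by ring.
  by apply: le_trans (ler_normD _ _) _; lra.
have ivx : mu.-integrable `]N, x] (EFin \o (fun t => isq t * F t - L * isq t)).
  case: pv => lv _; apply: (@locintS _ _ _ x) => // t/=.
  by rewrite !in_itv/= => /andP[Nt ->]; rewrite (le_trans N0 (ltW Nt)).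
have iqx : mu.-integrable `]N, x] (EFin \o isq).
  case: primitive_isq => lv _; apply: (@locintS _ _ _ x) => // t/=.
  by rewrite !in_itv/= => /andP[Nt ->]; rewrite (le_trans N0 (ltW Nt)).
rewrite -(primitive_sub pv)//.
apply: le_trans (le_normr_Rintegral _ ivx) _ => //.
apply: (@le_trans _ _ (\int[mu]_(t in `]N, x]) (e / 2 * isq t))).
  apply: le_Rintegral => //.
  - exact: integrable_norm ivx.
  - have := integrableZl _ (e / 2) iqx.
    by move=> /(_ (measurable_itv _)); apply: eq_integrable.
  - move=> t/=; rewrite in_itv/= => /andP[Nt tx].
    have t0 : 0 <= t by rewrite (le_trans N0)// ltW.
    rewrite mulrC -mulrBl normrM (gtr0_norm (isq_gt0 t0)).
    by rewrite ler_wpM2r ?(ltW (isq_gt0 t0))// HN// ltW.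
rewrite RintegralZl// (primitive_sub primitive_isq)// ler_wpM2l ?(ltW e20)//.
by rewrite gerBl -isq_int0 isq_int_le.
Qed.

Lemma integrable_phiM f : L2r D f ->
  mu.-integrable D (EFin \o (fun x => phi x * f x)).
Proof. exact: L2r_mul. Qed.

Lemma tailint_small f : L2r D f -> forall e, 0 < e ->
  exists2 N, 0 <= N & forall x, N <= x -> `|tailint f x - 0| <= e.
Proof.
move=> /integrable_phiM fi e /(tail_integral_small fi)[N N0 HN].
by exists N => // x Nx; rewrite subr0 HN.
Qed.

Lemma primitive_tailint f : L2r D f -> primitive (tailint f) (fun x => - (phi x * f x)).
Proof.
move=> Lf; have fi := integrable_phiM Lf; have lf := integrable_locint fi.
split=> [|x x0]; first exact: locintN.
rewrite /tailint (tail_integralE fi x0); congr (_ + _).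
rewrite -mulN1r -RintegralZl//.
by apply: eq_Rintegral => t _; rewrite mulN1r.
Qed.

Lemma primitive_usol f : L2r D f -> primitive (usol f) (fun x => isq x * tailint f x).
Proof.
move=> Lf; split=> [|x x0]; last by rewrite /usol set_itv1 Rintegral_set1 add0r.
apply: locintM; first exact: isq_continuous.
by apply/continuous_locint/primitive_continuous/primitive_tailint.
Qed.

Lemma usol0 f : usol f 0 = 0.
Proof. by rewrite /usol set_itv1 Rintegral_set1. Qed.

(** Since psi = phi isq_int, both branches of G have this single symmetric form. *)
Definition greenr x y := phi x * phi y * isq_int (Num.min x y).

Lemma integrable_greenr f x : L2r D f -> 0 <= x ->
  mu.-integrable D (EFin \o (fun y => greenr x y * f y)).
Proof.
move=> Lf x0.
have := integrableZl _ (phi x * isq_int x) (integrable_phiM Lf).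
move=> /(_ (measurable_itv _)); apply: le_integrable => //.
  apply/measurable_EFinP; apply: measurable_funM; last by case: Lf.
  apply: measurable_funM.
    by apply: measurable_funM => //; case: phiL2.
  (* Measurability in y comes from monotonicity. The maximum with 0 keeps arguments in the range of
     [isq_int_le] and changes nothing on the half line. *)
  have mA : measurable_fun setT (fun y => isq_int (Num.max 0 (Num.min x y))).
    apply: nondecreasing_measurable => // y z yz.
    apply: isq_int_le; first by rewrite le_max lexx.
    rewrite ge_max le_max lexx/= le_max; apply/orP; right.
    by rewrite le_min ge_min lexx/= ge_min yz orbT.
  apply: (eq_measurable_fun (fun y => isq_int (Num.max 0 (Num.min x y)))).
    move=> y; rewrite inE/= in_itv/= andbT => y0; rewrite max_r//.
    by rewrite le_min x0 ltW.
  exact: measurable_funS mA.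
move=> y /=; rewrite in_itv/= andbT => /ltW y0; rewrite lee_fin /greenr.
have m0 : 0 <= Num.min x y by rewrite le_min x0.
have Im0 : 0 <= isq_int (Num.min x y) by rewrite -isq_int0 isq_int_le.
have I0 : 0 <= isq_int x by rewrite -isq_int0 isq_int_le.
have ImI : isq_int (Num.min x y) <= isq_int x by rewrite isq_int_le// ge_min lexx.
rewrite !normrM (ger0_norm Im0) (ger0_norm I0).
have -> : `|phi x| * `|phi y| * isq_int (Num.min x y) * `|f y| =
  (`|phi x| * `|phi y| * `|f y|) * isq_int (Num.min x y) by ring.
have -> : `|phi x| * isq_int x * (`|phi y| * `|f y|) =
  (`|phi x| * `|phi y| * `|f y|) * isq_int x by ring.
by rewrite ler_wpM2l// !mulr_ge0.
Qed.

(** Split at x. On [x, oo) the kernel is phi(x) isq_int(x) phi(y), giving phi(x) isq_int(x) F(x)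
    with F the tail integral. On [0, x] the product rule for isq_int F, which vanishes at 0, turns
    the integral of isq_int phi f into that of isq F minus isq_int(x) F(x), and the boundary terms
    cancel. *)
Lemma greenr_integral f x : L2r D f -> 0 <= x ->
  \int[mu]_(y in D) (greenr x y * f y) = phi x * usol f x.
Proof.
move=> Lf x0; have iG := integrable_greenr Lf x0.
have fi := integrable_phiM Lf; have lf := integrable_locint fi.
have lG := integrable_locint iG.
have := primitiveM primitive_isq (primitive_tailint Lf).
set v := (fun x => _ + _) => -[lv /(_ _ x0)].
rewrite isq_int0 mul0r add0r => AF.
have -> : \int[mu]_(y in D) (greenr x y * f y) =
    \int[mu]_(y in `[0, x]) (greenr x y * f y) +
    \int[mu]_(y in `]x, +oo[) (greenr x y * f y).
  by rewrite (tail_integralE iG x0) addrC subrK.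
have -> : \int[mu]_(y in `]x, +oo[) (greenr x y * f y) = phi x * isq_int x * tailint f x.
  rewrite /tailint -RintegralZl//; last first.
    apply: integrableS fi => // t/=; rewrite !in_itv/= !andbT; exact: le_lt_trans.
  apply: eq_Rintegral => y; rewrite inE/= in_itv/= andbT => xy.
  by rewrite /greenr (min_idPl (ltW xy)); ring.
have pA := primitive_isq.
have lA : locint (fun y => isq_int y * (phi y * f y)).
  by apply: locintM => //; exact: primitive_continuous pA.
have -> : \int[mu]_(y in `[0, x]) (greenr x y * f y) =
    phi x * \int[mu]_(y in `[0, x]) (isq_int y * (phi y * f y)).
  rewrite -RintegralZl//.
  apply: eq_Rintegral => y; rewrite inE/= in_itv/= => /andP[y0 yx].
  by rewrite /greenr (min_idPr yx); ring.
rewrite -mulrA -mulrDr AF; congr (_ * _).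
rewrite -RintegralD//.
apply: eq_Rintegral => y _; rewrite /v; ring.
Qed.

End green.

(** * The quadratic form of G on real functions *)

Section form.
Context {R : realType}.
Notation mu := (@lebesgue_measure R).
Notation D := (`](0 : R), +oo[%classic).
Variables phi p : R -> R.
Hypotheses (phip : primitive phi p) (phi_gt0 : forall x, 0 <= x -> 0 < phi x).
Hypothesis phiL2 : L2r D phi.
Implicit Types (f g h : R -> R) (a x : R).

Lemma EFin_Rintegral (A : set (measurableTypeR R)) h : measurable A ->
  mu.-integrable A (EFin \o h) ->
  (\int[mu]_(x in A) (h x)%:E)%E = (\int[mu]_(x in A) h x)%:E.
Proof. by move=> mA ih; rewrite /Rintegral fineK//; exact: integrable_fin_num. Qed.

(** The triangle lemmas integrate over the whole line. This lemma and the next bring functions cut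
    off to the half line back to [tailint] and [usol]. *)
Lemma halfline_patch_tail h s : 0 <= s -> \int[mu]_(x in `]s, +oo[) (h \_ D) x =
  \int[mu]_(x in `]s, +oo[) h x.
Proof.
move=> s0; apply: eq_Rintegral => x; rewrite inE/= in_itv/= andbT => sx.
by rewrite patchE ifT// inE/= in_itv/= andbT (le_lt_trans s0).
Qed.

Lemma halfline_patch_initial h x : locint h -> \int[mu]_(s in `]-oo, x[) (h \_ D) s =
  \int[mu]_(s in `[0, x]) h s.
Proof.
move=> lh; rewrite -Rintegral_mkcondr.
have -> : `]-oo, x[ `&` D = `]0, x[%classic.
  apply/seteqP; split=> t /=; rewrite !in_itv/= ?andbT; first by move=> [-> ->].
  by move=> /andP[-> ->].
have lhx b : mu.-integrable [set` Interval (BRight 0) (BSide b x)] (EFin \o h).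
  apply: (@locintS _ _ _ x) => // t/=; rewrite !in_itv/= => /andP[/ltW ->].
  by move=> /lteifW.
by rewrite (Rintegral_itv_bndo_bndc (lhx true)) (Rintegral_itv_obnd_cbnd (lhx false)).
Qed.

Lemma integrable_patch_initial h x : locint h ->
  mu.-integrable `]-oo, x[ (EFin \o (h \_ D)).
Proof.
move=> lh; rewrite -restrict_EFin; apply/integrable_restrict => //.
apply: (@locintS _ _ _ x) => //; first exact: measurableI.
by move=> t /= [] ; rewrite !in_itv/= andbT => /ltW -> /ltW ->.
Qed.

Lemma measurable_patch h : measurable_fun D h -> measurable_fun setT (h \_ D).
Proof. by move=> mh; apply/(measurable_restrictT _ _).1. Qed.

Lemma halfline_measurable h : {within `[0, +oo[, continuous h} -> measurable_fun D h.
Proof.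
move=> /continuous_measurable; apply: measurable_funS => // x/=.
by rewrite !in_itv/= !andbT => /ltW.
Qed.

Lemma locint_measurable_halfline h : locint h -> measurable_fun D h.
Proof.
move=> /locint_measurable; apply: measurable_funS => // x/=.
by rewrite !in_itv/= !andbT => /ltW.
Qed.

Lemma isq_ge0 x : 0 <= isq phi x.
Proof. by rewrite invr_ge0 sqr_ge0. Qed.

Lemma norm_tailint f x : L2r D f -> 0 <= x ->
  `|tailint phi f x| <= tailint phi (fun t => `|f t|) x.
Proof.
move=> Lf x0; have fi := integrable_phiM phiL2 Lf.
apply: le_trans (le_normr_Rintegral _ _) _ => //.
  apply: integrableS fi => // t/=; rewrite !in_itv/= !andbT; exact: le_lt_trans.
rewrite le_eqVlt; apply/orP; left; apply/eqP.
apply: eq_Rintegral => t; rewrite inE/= in_itv/= andbT => xt.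
by rewrite normrM gtr0_norm// phi_gt0// (le_trans x0)// ltW.
Qed.

Lemma tailint_continuous f : L2r D f -> {within `[0, +oo[, continuous (tailint phi f)}.
Proof. by move=> Lf; exact: primitive_continuous (primitive_tailint phiL2 Lf). Qed.

Lemma phi_neq0 x : 0 <= x -> phi x != 0.
Proof. by move=> x0; rewrite gt_eqF// phi_gt0. Qed.

Lemma inv_phi_continuous : {within `[0, +oo[, continuous (fun x => (phi x)^-1)}.
Proof.
have /subspace_continuousP cphi := primitive_continuous phip.
apply/subspace_continuousP => x Ax; apply: cvgV; last exact: cphi.
by apply: phi_neq0; move: Ax; rewrite /= in_itv/= andbT.
Qed.

Lemma tailint_phi_measurable f : L2r D f ->
  measurable_fun D (fun x => (phi x)^-1 * tailint phi f x).
Proof.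
move=> Lf; apply: measurable_funM.
  by apply: halfline_measurable; exact: inv_phi_continuous.
by apply: halfline_measurable; exact: tailint_continuous.
Qed.

(* By Tonelli, the integral of (F / phi)^2, with F the tail integral of
   phi |f|, equals <|f|, G |f|>. *)
Lemma tailint_L2 f : L2r D f ->
  L2r D (fun x => phi x * usol phi (fun t => `|f t|) x) ->
  L2r D (fun x => (phi x)^-1 * tailint phi f x).
Proof.
move=> Lf LG.
have LN := L2r_norm (measurable_itv _) Lf.
set F := tailint phi (fun t => `|f t|).
have F0 x : 0 <= x -> 0 <= F x.
  by move=> x0; exact: le_trans (normr_ge0 _) (norm_tailint Lf x0).
(* [F] dominates the absolute value of the tail integral of phi f, so only the nonnegative case is
   left. *)
suff LF : L2r D (fun x => (phi x)^-1 * F x).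
  apply: (L2r_le _ (tailint_phi_measurable Lf) LF) => // x /=.
  rewrite in_itv/= andbT => /ltW x0.
  rewrite !normrM ler_wpM2l// (ger0_norm (F0 _ x0)); exact: norm_tailint.
have pF := primitive_tailint phiL2 LN.
have pu := primitive_usol phip phi_gt0 phiL2 LN.
have lu : locint (fun x => isq phi x * F x) by case: pu.
have ib := integrable_phiM phiL2 LN.
pose a := (fun x => isq phi x * F x) \_ D.
pose b := (fun x => phi x * `|f x|) \_ D.
have ma : measurable_fun setT a.
  by apply: measurable_patch; exact: locint_measurable_halfline.
have mb : measurable_fun setT b.
  by apply: measurable_patch; apply/measurable_EFinP; exact: measurable_int ib.
have a0 x : 0 <= a x.
  rewrite /a patchE; case: ifPn => //; rewrite inE/= in_itv/= andbT => /ltW x0.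
  by rewrite mulr_ge0 ?isq_ge0// F0.
have b0 x : 0 <= b x.
  rewrite /b patchE; case: ifPn => //; rewrite inE/= in_itv/= andbT => /ltW x0.
  by rewrite mulr_ge0// ltW// phi_gt0.
split; first exact: tailint_phi_measurable.
have ibs s : 0 <= s -> mu.-integrable `]s, +oo[ (EFin \o b).
  by move=> s0; apply: (integrableS measurableT) => //; exact: integrable_patch.
(* (F / phi)^2 is isq F times F, and unfolding the second factor as a tail integral exhibits the
   triangle. *)
have -> : (\int[mu]_(x in D) (((phi x)^-1 * F x) ^+ 2)%:E =
    \int[mu]_s ((a s)%:E * \int[mu]_(x in `]s, +oo[) (b x)%:E))%E.
  rewrite integral_mkcond; apply: eq_integral => s _.
  rewrite /a !patchE; case: ifPn; last by rewrite mul0e.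
  rewrite inE/= in_itv/= andbT => /ltW s0.
  rewrite EFin_Rintegral//; last exact: ibs.
  rewrite halfline_patch_tail// -EFinM; congr EFin; rewrite -/(tailint phi _ s) -/F.
  by rewrite /isq exprMn -exprVn; ring.
rewrite triangle_tonelli//.
have iG : mu.-integrable D (EFin \o (fun x => `|f x| * (phi x * usol phi (fun t => `|f t|) x))).
  exact: L2r_mul LN LG.
rewrite (_ : (\int[mu]_x _)%E = (\int[mu]_(x in D) (`|f x| * (phi x * usol phi (fun t => `|f t|) x))%:E)%E).
  exact: integrable_lty.
rewrite [RHS]integral_mkcond; apply: eq_integral => x _.
rewrite /b !patchE; case: ifPn; last by rewrite mul0e.
rewrite inE/= in_itv/= andbT => /ltW x0.
rewrite EFin_Rintegral//; last exact: integrable_patch_initial.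
by rewrite halfline_patch_initial// -EFinM; congr EFin; rewrite -/(usol phi _ x); ring.
Qed.

(** Fubini on the triangle with weights isq F2 and phi f1, where Fi is the tail integral of phi fi.
    Its absolute bound is the integral of a product of two square integrable functions: F2 / phi,
    and the analogue of F1 / phi for |f1|. This is why [tailint_L2] is also applied to |f1|. *)
Lemma green_form f1 f2 : L2r D f1 -> L2r D f2 ->
  L2r D (fun x => phi x * usol phi (fun t => `|f1 t|) x) ->
  L2r D (fun x => phi x * usol phi (fun t => `|f2 t|) x) ->
  [/\ mu.-integrable D (EFin \o (fun x => tailint phi f1 x * tailint phi f2 x * isq phi x)),
      mu.-integrable D (EFin \o (fun x => f1 x * (phi x * usol phi f2 x))) &
      \int[mu]_(x in D) (f1 x * (phi x * usol phi f2 x)) =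
      \int[mu]_(x in D) (tailint phi f1 x * tailint phi f2 x * isq phi x)].
Proof.
move=> L1 L2 G1 G2.
have LF1 := tailint_L2 L1 G1; have LF2 := tailint_L2 L2 G2.
have LN1 := L2r_norm (measurable_itv _) L1.
have LNF1 : L2r D (fun x => (phi x)^-1 * tailint phi (fun t => `|f1 t|) x).
  have E : (fun t => `| `|f1 t| |) = (fun t => `|f1 t|) by apply/funext => t; rewrite normr_id.
  by apply: (tailint_L2 LN1); rewrite E.
have i1 := integrable_phiM phiL2 L1.
have pu := primitive_usol phip phi_gt0 phiL2 L2.
have lu : locint (fun x => isq phi x * tailint phi f2 x) by case: pu.
pose a := (fun x => isq phi x * tailint phi f2 x) \_ D.
pose b := (fun x => phi x * f1 x) \_ D.
have ma : measurable_fun setT a.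
  by apply: measurable_patch; exact: locint_measurable_halfline.
have ib : mu.-integrable setT (EFin \o b) by exact: integrable_patch.
have mb : measurable_fun setT b by apply/measurable_EFinP; exact: measurable_int ib.
have ibs s : mu.-integrable `]s, +oo[ (EFin \o b).
  by apply: (integrableS measurableT).
have ias s : mu.-integrable `]-oo, s[ (EFin \o a) by exact: integrable_patch_initial.
have iab : (\int[mu]_s (`|a s|%:E * \int[mu]_(x in `]s, +oo[) `|b x|%:E) < +oo)%E.
  have i12 := integrable_norm (L2r_mul (measurable_itv _) LNF1 LF2).
  apply: le_lt_trans (integrable_lty _ i12); last exact: measurable_itv.
  rewrite le_eqVlt; apply/orP; left; apply/eqP.
  rewrite [RHS]integral_mkcond; apply: eq_integral => s _.
  rewrite /a !patchE; case: ifPn; last by rewrite normr0 mul0e.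
  rewrite inE/= in_itv/= andbT => /ltW s0.
  rewrite EFin_Rintegral//; last exact: integrable_norm (ibs s).
  rewrite -EFinM; congr EFin.
  have -> : \int[mu]_(x in `]s, +oo[) `|b x| = tailint phi (fun t => `|f1 t|) s.
    apply: eq_Rintegral => x; rewrite inE/= in_itv/= andbT => sx.
    have x0 : 0 < x by rewrite (le_lt_trans s0).
    by rewrite /b patchE ifT ?inE/= ?in_itv/= ?x0// normrM gtr0_norm// phi_gt0// ltW.
  have F0 : 0 <= tailint phi (fun t => `|f1 t|) s by exact: le_trans (normr_ge0 _) (norm_tailint L1 s0).
  rewrite !normrM (ger0_norm F0) (ger0_norm (isq_ge0 s)) normfV (gtr0_norm (phi_gt0 s0)).
  by rewrite /isq -exprVn; ring.
have [_ I2 E12] := triangle_fubini ma mb ias ibs iab.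
have i12 : mu.-integrable D (EFin \o (fun x => tailint phi f1 x * tailint phi f2 x * isq phi x)).
  have := L2r_mul (measurable_itv _) LF1 LF2; apply: eq_integrable => // x _ /=.
  by rewrite /isq -exprVn; congr EFin; ring.
have bE : (fun x => b x * \int[mu]_(s in `]-oo, x[) a s) =
    (fun x => f1 x * (phi x * usol phi f2 x)) \_ D.
  apply/funext => x; rewrite /b !patchE; case: ifPn; last by rewrite mul0r.
  rewrite inE/= in_itv/= andbT => /ltW x0.
  by rewrite halfline_patch_initial// -/(usol phi _ x); ring.
have aE : (fun s => a s * \int[mu]_(x in `]s, +oo[) b x) =
    (fun x => tailint phi f1 x * tailint phi f2 x * isq phi x) \_ D.
  apply/funext => s; rewrite /a !patchE; case: ifPn; last by rewrite mul0r.
  rewrite inE/= in_itv/= andbT => /ltW s0.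
  by rewrite halfline_patch_tail// -/(tailint phi _ s); ring.
split => //.
  by apply/integrable_mkcond => //; rewrite restrict_EFin -bE.
by rewrite Rintegral_mkcond -bE -E12 aE -Rintegral_mkcond.
Qed.

End form.

(** * Complex-valued functions *)

Section complex_parts.
Variable R : rcfType.
Implicit Types (z w : R[i]) (a : R).
Local Notation Re := complex.Re.
Local Notation Im := complex.Im.

Lemma eqC z w : Re z = Re w -> Im z = Im w -> z = w.
Proof. by case: z w => a b [c d] /= -> ->. Qed.

Lemma ReD z w : Re (z + w) = Re z + Re w. Proof. by case: z w => ? ? []. Qed.
Lemma ImD z w : Im (z + w) = Im z + Im w. Proof. by case: z w => ? ? []. Qed.
Lemma ReN z : Re (- z) = - Re z. Proof. by case: z. Qed.
Lemma ImN z : Im (- z) = - Im z. Proof. by case: z. Qed.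
Lemma ReM z w : Re (z * w) = Re z * Re w - Im z * Im w.
Proof. by case: z w => ? ? []. Qed.
Lemma ImM z w : Im (z * w) = Re z * Im w + Im z * Re w.
Proof. by case: z w => ? ? []. Qed.
Lemma ReJ z : Re z^* = Re z. Proof. by case: z. Qed.
Lemma ImJ z : Im z^* = - Im z. Proof. by case: z. Qed.

Definition partsE := (ReD, ImD, ReN, ImN, ReM, ImM, ReJ, ImJ).

Lemma realC_inv a : (a%:C)^-1 = (a^-1)%:C.
Proof. by rewrite fmorphV. Qed.

Lemma sqr_normc_parts z :
  ComplexField.Normc.normc z ^+ 2 = Re z ^+ 2 + Im z ^+ 2.
Proof. by case: z => a b; rewrite sqr_sqrtr// addr_ge0 ?sqr_ge0. Qed.

Lemma normC_le_parts z : `|z| <= (`|Re z| + `|Im z|)%:C.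
Proof.
rewrite normc_def lecR.
have s0 : 0 <= `|Re z| + `|Im z| by rewrite addr_ge0.
rewrite -(ger0_norm s0) -(sqrtr_sqr (`|Re z| + `|Im z|)); apply: ler_wsqrtr.
rewrite sqrrD !real_normK ?num_real//.
by rewrite lerD2r lerDl mulrn_wge0// mulr_ge0.
Qed.

Lemma normC_ge_Re z e : `|z| < e%:C -> `|Re z| < e.
Proof. by rewrite -ltcR; apply: le_lt_trans; exact: normc_ge_Re. Qed.

Lemma normC_ge_Im z e : `|z| < e%:C -> `|Im z| < e.
Proof.
move=> ze; rewrite -normrN -ReiNIm; apply: normC_ge_Re.
by rewrite normrM (normc_def (Complex 0 1)) /= expr0n expr1n add0r sqrtr1 mulr1.
Qed.

End complex_parts.

Section complex_functions.
Context {R : realType}.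
Notation mu := (@lebesgue_measure R).
Notation D := (`](0 : R), +oo[%classic).
Implicit Types (f g h u v : R -> R[i]).
Local Notation Re := complex.Re.
Local Notation Im := complex.Im.

(** With |f|^2 = Re^2 + Im^2, this equivalence, [L2locP] and [is_wderivP] reduce the complex
    statements to real components. *)
Lemma L2onP (A : set (measurableTypeR R)) f : measurable A ->
  L2on A f <-> L2r A (fun x => Re (f x)) /\ L2r A (fun x => Im (f x)).
Proof.
move=> mA; split=> [[[mr mi] fi]|[Lr Li]].
  have le (h : R -> R) : measurable_fun A h ->
      (forall x, h x ^+ 2 <= ComplexField.Normc.normc (f x) ^+ 2) -> L2r A h.
    move=> mh hf; split=> //; apply: le_lt_trans fi; apply: ge0_le_integral => //.
    - by move=> x _; rewrite lee_fin sqr_ge0.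
    - by apply/measurable_EFinP; exact: measurable_funX.
    - apply/measurable_EFinP.
      under eq_fun do rewrite sqr_normc_parts.
      by apply: measurable_funD; exact: measurable_funX.
    - by move=> x _; rewrite lee_fin.
  by split; apply: le => // x; rewrite sqr_normc_parts ?lerDl ?lerDr sqr_ge0.
split; first by split; [case: Lr|case: Li].
have := integrable_lty mA (integrableD mA (L2r_sqr mA Lr) (L2r_sqr mA Li)).
congr (_ < _)%E; apply: eq_integral => x _.
by rewrite /= sqr_normc_parts.
Qed.

Lemma L2P f : L2 f <-> L2r D (fun x => Re (f x)) /\ L2r D (fun x => Im (f x)).
Proof. exact: L2onP. Qed.

Lemma L2locP f : L2loc f <-> L2rloc (fun x => Re (f x)) /\ L2rloc (fun x => Im (f x)).
Proof.
split=> [Lf|[Lr Li] a a0].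
  by split=> a a0; have /L2onP[] := Lf a a0.
by apply/L2onP => //; split; [exact: Lr|exact: Li].
Qed.

Lemma is_wderivP f g : is_wderiv f g <->
  [/\ L2loc g, primitive (fun x => Re (f x)) (fun x => Re (g x)) &
      primitive (fun x => Im (f x)) (fun x => Im (g x))].
Proof.
split=> [[Lg fg]|[Lg [_ fr] [_ fi]]].
  have /L2locP[Lr Li] := Lg.
  split=> //; split; do ?exact: L2rloc_locint.
    by move=> x x0; rewrite {1}fg// ReD.
  by move=> x x0; rewrite {1}fg// ImD.
split=> // x x0; apply: eqC; rewrite !partsE /=; [exact: fr|exact: fi].
Qed.

Lemma within_continuous_parts f :
  {within `[0, +oo[, continuous (fun x => Re (f x))} ->
  {within `[0, +oo[, continuous (fun x => Im (f x))} ->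
  {within `[0, +oo[, continuous (f : R -> Cfield R)}.
Proof.
move=> /subspace_continuousP cr /subspace_continuousP ci.
apply/subspace_continuousP => x Ax.
apply/cvgrPdist_lt => /= e e0.
(* A positive element of R[i] is real, so epsilon can be halved in R. *)
have eE : e = (Re e)%:C by apply: eqC => //=; move: e0; rewrite ltcE => /andP[/eqP].
have e20 : 0 < Re e / 2 by rewrite divr_gt0//; move: e0; rewrite ltcE => /andP[].
have /cvgrPdist_lt/(_ _ e20) Hr := cr x Ax.
have /cvgrPdist_lt/(_ _ e20) Hi := ci x Ax.
move: Hr Hi; apply: filterS2 => y Hr Hi.
apply: le_lt_trans (normC_le_parts _) _; rewrite [ltRHS]eE ltcR.
by rewrite !partsE; lra.
Qed.

Lemma W_intro f g : is_wderiv f g -> W f.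
Proof.
move=> fg; split; last by exists g.
have /is_wderivP[_ pr pi] := fg.
apply: within_continuous_parts; [exact: primitive_continuous pr|exact: primitive_continuous pi].
Qed.

Lemma wderivP f : W f -> is_wderiv f (wderiv f).
Proof. by move=> [_ [g fg]]; apply: (xgetPex (fun=> 0)); exists g. Qed.

Lemma wderiv_unique f g : is_wderiv f g -> aeq (wderiv f) g.
Proof.
move=> fg; have /wderivP/is_wderivP[_ pr pi] := W_intro fg.
have /is_wderivP[_ qr qi] := fg.
have := primitive_unique pr qr; have := primitive_unique pi qi.
by apply: ae_mono2 => x Hi Hr Dx; apply: eqC; [exact: Hr|exact: Hi].
Qed.

Lemma eq_is_wderiv f1 f2 g : (forall x, 0 <= x -> f1 x = f2 x) ->
  is_wderiv f1 g -> is_wderiv f2 g.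
Proof. by move=> f12 [Lg fg]; split=> // x x0; rewrite -!f12// fg. Qed.

(** If the difference is nonzero at [a], continuity keeps it nonzero on some ]a, a + e[, which has
    positive measure. A right neighbourhood is used so that a = 0 is included. *)
Lemma primitive_ae_eq (f1 f2 g1 g2 : R -> R) : primitive f1 g1 -> primitive f2 g2 ->
  f1 = f2 %[ae mu in D] -> forall x, 0 <= x -> f1 x = f2 x.
Proof.
move=> p1 p2 f12 a a0; apply/eqP; rewrite -subr_eq0; apply/negP => /negP da.
pose d x := f1 x - f2 x.
have pd := primitiveB p1 p2.
have /continuous_within_itvcyP[cd cd0] := primitive_continuous pd.
have cr : d x @[x --> a^'+] --> d a.
  move: a0; rewrite le_eqVlt => /predU1P[<- //|a0].
  by apply: cvg_at_right_filter; apply: cd; rewrite in_itv/= andbT.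
have /cvgrPdist_lt/(_ `|d a|) := cr; rewrite normr_gt0 => /(_ da).
move=> -[e /= e0 He].
have [N [mN N0 dN]] := f12.
have sub : `]a, a + e[ `<=` N.
  move=> x/=; rewrite in_itv/= => /andP[ax xe]; apply: dN => /=.
  apply/not_implyP; split; first by rewrite in_itv/= andbT (le_lt_trans a0).
  move=> E; have := He x; rewrite /ball/= ltr_distlC.
  have -> : d x = 0 by rewrite /d E subrr.
  rewrite subr0 ltxx => He'; suff : false by [].
  apply: He' => //.
  by rewrite xe andbT; apply: lt_trans ax; rewrite gtrBl.
have : (mu `]a, (a + e)%R[ <= mu N)%E by apply: le_measure; rewrite ?inE.
rewrite [X in (_ <= X)%E]N0 lebesgue_measure_itv/= lte_fin ltrDl e0.
by rewrite -EFinB lee_fin addrAC subrr add0r leNgt e0.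
Qed.

Lemma W_aeq u v : W u -> W v -> aeq u v -> forall x, 0 <= x -> u x = v x.
Proof.
move=> /wderivP/is_wderivP[_ pr pi] /wderivP/is_wderivP[_ qr qi] uv x x0.
apply: eqC.
  by apply: (primitive_ae_eq pr qr) => //; move: uv; apply: ae_mono => y /[apply] ->.
by apply: (primitive_ae_eq pi qi) => //; move: uv; apply: ae_mono => y /[apply] ->.
Qed.

Lemma crepP u : Defs.aeW u -> W (crep u) /\ aeq u (crep u).
Proof. by move=> [h Wh uh]; apply: (xgetPex u (P := [set v | W v /\ aeq u v])); exists h. Qed.

(** Elements of [W] that agree almost everywhere agree on all of [0, oo), so the choice made by
    [crep] does not matter there, not even at 0. *)
Lemma crepE u h : W h -> aeq u h -> forall x, 0 <= x -> crep u x = h x.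
Proof.
move=> Wh uh; have [|Wc uc] := @crepP u; first by exists h.
apply: W_aeq => //; move: uh uc; apply: ae_mono2 => x uh uc Dx.
by rewrite -uh// -uc.
Qed.

Lemma aeq_trans u v w : aeq u v -> aeq v w -> @aeq R u w.
Proof. by apply: ae_mono2 => x uv vw Dx; rewrite uv// vw. Qed.

Lemma aeq_sym u v : aeq u v -> @aeq R v u.
Proof. by apply: ae_mono => x uv Dx; rewrite uv. Qed.

Lemma L2_aeq f g : L2 f -> cmeasurable D g -> aeq f g -> L2 g.
Proof.
move=> /L2P[Lr Li] [mr mi] fg; apply/L2P; split.
  by apply: L2r_ae mr Lr _; move: fg; apply: ae_mono => x /[apply] ->.
by apply: L2r_ae mi Li _; move: fg; apply: ae_mono => x /[apply] ->.
Qed.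

Lemma L2N f : L2 f -> L2 (fun x => - f x).
Proof.
move=> /L2P[Lr Li]; apply/L2P; split.
  rewrite (_ : (fun x => _) = (fun x => -1 * Re (f x))); first exact: L2rZ.
  by apply/funext => x; rewrite ReN mulN1r.
rewrite (_ : (fun x => _) = (fun x => -1 * Im (f x))); first exact: L2rZ.
by apply/funext => x; rewrite ImN mulN1r.
Qed.

Lemma cmeasurable_wderiv h : W h -> cmeasurable D (wderiv h).
Proof.
move=> /wderivP/is_wderivP[_ [lr _] [li _]].
by split; exact: locint_measurable_halfline.
Qed.

Lemma cmeasurable_W h : W h -> cmeasurable D h.
Proof.
move=> /wderivP/is_wderivP[_ pr pi]; split.
  exact: halfline_measurable (primitive_continuous pr).
exact: halfline_measurable (primitive_continuous pi).
Qed.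

Lemma cmeasurableM f g : cmeasurable D f -> cmeasurable D g ->
  cmeasurable D (fun x => f x * g x).
Proof.
move=> [fr fi] [gr gi]; split=> /=.
  apply: (eq_measurable_fun (fun x => Re (f x) * Re (g x) - Im (f x) * Im (g x))).
    by move=> x _; rewrite ReM.
  by apply: measurable_funB; exact: measurable_funM.
apply: (eq_measurable_fun (fun x => Re (f x) * Im (g x) + Im (f x) * Re (g x))).
  by move=> x _; rewrite ImM.
by apply: measurable_funD; exact: measurable_funM.
Qed.

Lemma cmeasurable_real (h : R -> R) : measurable_fun D h ->
  cmeasurable D (fun x => (h x)%:C).
Proof. by move=> mh; split=> //=; exact: measurable_cst. Qed.

Lemma cmeasurableB f g : cmeasurable D f -> cmeasurable D g ->
  cmeasurable D (fun x => f x - g x).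
Proof.
move=> [fr fi] [gr gi]; split.
  apply: (eq_measurable_fun (fun x => Re (f x) - Re (g x))).
    by move=> x _; rewrite !partsE.
  exact: measurable_funB.
apply: (eq_measurable_fun (fun x => Im (f x) - Im (g x))).
  by move=> x _; rewrite !partsE.
exact: measurable_funB.
Qed.

Lemma cmeasurableJ f : cmeasurable D f -> cmeasurable D (fun x => (f x)^*).
Proof.
move=> [fr fi]; split.
  by apply: eq_measurable_fun fr => x _; rewrite ReJ.
apply: (eq_measurable_fun (fun x => - Im (f x))); first by move=> x _; rewrite ImJ.
exact: measurable_funN.
Qed.

Lemma Rintegral_aeE (h1 h2 : R -> R) : mu.-integrable D (EFin \o h1) ->
  measurable_fun D h2 -> h1 = h2 %[ae mu in D] ->
  mu.-integrable D (EFin \o h2) /\ \int[mu]_(x in D) h2 x = \int[mu]_(x in D) h1 x.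
Proof.
move=> i1 m2 h12.
have ae2 : ae_eq mu D (EFin \o h1) (EFin \o h2).
  by move: h12; apply: ae_mono => x h12 Dx /=; rewrite h12.
have m1 := measurable_int mu i1.
have m2' : measurable_fun D (EFin \o h2) by apply/measurable_EFinP.
split.
  apply/integrableP; split=> //; have /integrableP[_] := i1.
  congr (_ < _)%E; apply: ae_eq_integral => //.
  - exact: measurableT_comp.
  - exact: measurableT_comp.
  - exact: ae_eq_abse.
by congr fine; apply: ae_eq_integral => //; exact: ae_eq_sym.
Qed.

Lemma cint_ae f g : cintegrable D f -> cmeasurable D g -> aeq f g ->
  cintegrable D g /\ cint D g = cint D f.
Proof.
move=> [ir ii] [mr mi] fg.
have [jr er] : mu.-integrable D (EFin \o (fun x => Re (g x))) /\
    \int[mu]_(x in D) Re (g x) = \int[mu]_(x in D) Re (f x).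
  by apply: Rintegral_aeE => //; move: fg; apply: ae_mono => x /[apply] ->.
have [ji ei] : mu.-integrable D (EFin \o (fun x => Im (g x))) /\
    \int[mu]_(x in D) Im (g x) = \int[mu]_(x in D) Im (f x).
  by apply: Rintegral_aeE => //; move: fg; apply: ae_mono => x /[apply] ->.
by split=> //; rewrite /cint er ei.
Qed.

(** The shape of the real and imaginary parts of f1 times the conjugate of G_gamma f2: two terms
    from G, with s = 1 or s = -1, and two from the rank one part. *)
Lemma Rintegral_comb (s a b : R) (h1 h2 h3 h4 : R -> R) :
  mu.-integrable D (EFin \o h1) -> mu.-integrable D (EFin \o h2) ->
  mu.-integrable D (EFin \o h3) -> mu.-integrable D (EFin \o h4) ->
  \int[mu]_(x in D) (h1 x + s * h2 x + (a * h3 x + b * h4 x)) =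
  \int[mu]_(x in D) h1 x + s * \int[mu]_(x in D) h2 x +
  (a * \int[mu]_(x in D) h3 x + b * \int[mu]_(x in D) h4 x).
Proof.
move=> i1 i2 i3 i4.
have iZ (c : R) (h0 : R -> R) : mu.-integrable D (EFin \o h0) ->
    mu.-integrable D (EFin \o (fun x => c * h0 x)).
  move=> ih; have := integrableZl _ c ih.
  by move=> /(_ (measurable_itv _)); apply: eq_integrable.
have iD (k1 k2 : R -> R) : mu.-integrable D (EFin \o k1) -> mu.-integrable D (EFin \o k2) ->
    mu.-integrable D (EFin \o (fun x => k1 x + k2 x)).
  move=> j1 j2; have := integrableD _ j1 j2.
  by move=> /(_ (measurable_itv _)); apply: eq_integrable.
have j2 := iZ s _ i2; have j3 := iZ a _ i3; have j4 := iZ b _ i4.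
rewrite (RintegralD _ (iD _ _ i1 j2) (iD _ _ j3 j4))//.
by rewrite (RintegralD _ i1 j2)// (RintegralD _ j3 j4)// !RintegralZl.
Qed.

End complex_functions.

(** * Both directions of the description of the range, for real components *)

Section components.
Context {R : realType}.
Notation mu := (@lebesgue_measure R).
Notation D := (`](0 : R), +oo[%classic).
Variables phi p : R -> R.
Hypotheses (phip : primitive phi p) (phi_gt0 : forall x, 0 <= x -> 0 < phi x).
Hypotheses (phiL2 : L2r D phi) (pL2 : L2rloc p).
Implicit Types (f g h : R -> R) (a x c : R).

Lemma continuous_L2rloc h : {within `[0, +oo[, continuous h} -> L2rloc h.
Proof.
move=> ch a a0.
have L1 : L2rloc (fun=> 1 : R).
  move=> b b0; split=> //; rewrite integral_cst//= lebesgue_measure_itv/=.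
  by rewrite lte_fin b0 -EFinB -EFinM ltry.
have [mh h2] := L2rlocM ch L1 a0.
split; first by apply: eq_measurable_fun mh => x _; rewrite mulr1.
by move: h2; congr (_ < _)%E; apply: eq_integral => x _; rewrite mulr1.
Qed.

Lemma L2rloc_eq f g : (forall x, f x = g x) -> L2rloc f -> L2rloc g.
Proof. by move=> /funext ->. Qed.

Lemma primitive_green f c : L2r D f ->
  primitive (fun x => phi x * (c + usol phi f x))
    (fun x => phi x * (isq phi x * tailint phi f x) + (c + usol phi f x) * p x).
Proof.
move=> Lf; have pu := primitive_usol phip phi_gt0 phiL2 Lf.
have pv := primitiveD (primitive_cst c) pu.
apply: eq_primitive_deriv (primitiveM phip pv) => x _; by rewrite add0r.
Qed.

Lemma primitive_add_usol f c : L2r D f ->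
  primitive (fun x => c + usol phi f x) (fun x => isq phi x * tailint phi f x).
Proof.
move=> Lf; have pu := primitive_usol phip phi_gt0 phiL2 Lf.
by apply: eq_primitive_deriv (primitiveD (primitive_cst c) pu) => x _; rewrite add0r.
Qed.

Lemma L2rloc_green f c : L2r D f ->
  L2rloc (fun x => phi x * (isq phi x * tailint phi f x) + (c + usol phi f x) * p x).
Proof.
move=> Lf; apply: L2rlocD.
  apply: L2rlocM; first exact: primitive_continuous phip.
  apply: L2rlocM; first exact: (isq_continuous phip phi_gt0).
  exact/continuous_L2rloc/tailint_continuous.
by apply: L2rlocM => //; exact: primitive_continuous (primitive_add_usol c Lf).
Qed.

Lemma psiE x : psi phi x = phi x * isq_int phi x.
Proof. by []. Qed.

(** The factor phi cancels against psi = phi isq_int, and [ratio_limit] applies with L = 0 because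
    the tail integral vanishes at infinity. The constant [c] is harmless since isq_int diverges. *)
Lemma green_ratio f c : L2r D f -> forall e, 0 < e -> exists2 N, 0 <= N &
  forall x, N <= x -> `|phi x * (c + usol phi f x) / psi phi x| <= e.
Proof.
move=> Lf e e0.
have [N N0 HN] := ratio_limit phip phi_gt0 phiL2 (primitive_add_usol c Lf)
  (tailint_small phiL2 Lf) e0.
exists N => // x Nx; have [_] := HN _ Nx; rewrite subr0 psiE.
rewrite -mulf_div divff ?mul1r//.
by apply: (phi_neq0 phi_gt0); exact: le_trans Nx.
Qed.

(** The converse direction for one real component. The value g 0 stays free: the boundary condition
    involves gamma, mixes the two components, and is imposed only afterwards. *)
Lemma green_component f g g' F : L2r D f -> primitive g g' ->
  primitive F (fun x => - (phi x * f x)) ->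
  (fun x => phi x * g' x - p x * g x) = F %[ae mu in D] ->
  (forall e, 0 < e -> exists2 N, 0 <= N & forall x, N <= x -> `|g x / psi phi x| <= e) ->
  (forall x, 0 <= x -> F x = tailint phi f x) /\
  (forall x, 0 <= x -> g x = phi x * (g 0 / phi 0 + usol phi f x)).
Proof.
move=> Lf pg pF wF glim.
have liF : locint (fun x => isq phi x * F x).
  apply: locintM; first exact: (isq_continuous phip phi_gt0).
  exact/continuous_locint/primitive_continuous/pF.
pose u x := g 0 / phi 0 + \int[mu]_(t in `[0, x]) (isq phi t * F t).
have pu : primitive u (fun x => isq phi x * F x) by exact: primitive_int.
have pd := primitiveB pg (primitiveM phip pu).
have u0 : u 0 = g 0 / phi 0 by rewrite /u set_itv1 Rintegral_set1 addr0.
have lk : locint (fun x => (phi x)^-1 * p x).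
  by apply: locintM; [exact: (inv_phi_continuous phip phi_gt0)|case: phip].
have gu x : 0 <= x -> g x = phi x * u x.
  move=> x0; apply/eqP; rewrite -subr_eq0; apply/eqP; move: x x0.
  apply: (linear_ode_unique lk) => //; last first.
    by rewrite u0 mulrC divfK ?subrr// (phi_neq0 phi_gt0).
  (* Inserting g' = (F + p g) / phi and phi isq F = F / phi turns the density of g - phi u into (p /
     phi) (g - phi u). *)
  apply: (primitive_ae pd).
    apply: locint_measurable.
    apply: locint_eq (locintM (primitive_continuous pd) lk) => x _; by rewrite mulrC.
  move: wF; apply: ae_mono => x wF Dx.
  have := wF Dx; move: Dx; rewrite /= in_itv/= andbT => /ltW/(phi_neq0 phi_gt0) px <-.
  by rewrite /isq; field.
(* Both functions have density -phi f, so their difference keeps its value at 0; as the tail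
   integral vanishes at infinity, [L] is also the limit of [F]. *)
pose L := F 0 - tailint phi f 0.
have FL x : 0 <= x -> F x - L = tailint phi f x.
  move=> x0; have [_ ->//] := pF; have [_ ->//] := primitive_tailint phiL2 Lf.
  by rewrite /L; ring.
have FLs e : 0 < e -> exists2 N, 0 <= N & forall x, N <= x -> `|F x - L| <= e.
  move=> /(tailint_small phiL2 Lf)[N N0 HN]; exists N => // x Nx.
  by rewrite FL ?(le_trans N0)//; have := HN _ Nx; rewrite subr0.
have L0 : L = 0.
  apply/eqP; rewrite -normr_le0; apply/ler_addgt0Pr => e e0; rewrite add0r.
  have e20 : 0 < e / 2 by rewrite divr_gt0.
  have [N N0 HN] := ratio_limit phip phi_gt0 phiL2 pu FLs e20.
  have [N' N'0 HN'] := glim _ e20.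
  pose x := Num.max N N'.
  have x0 : 0 <= x by rewrite le_max N0.
  have [_ H1] : 0 < isq_int phi x /\ `|u x / isq_int phi x - L| <= e / 2.
    by apply: HN; rewrite le_max lexx.
  have := HN' x; rewrite le_max lexx orbT => /(_ isT).
  rewrite gu// psiE -mulf_div divff ?mul1r ?(phi_neq0 phi_gt0)// => H2.
  have -> : L = u x / isq_int phi x - (u x / isq_int phi x - L) by ring.
  by apply: le_trans (ler_normB _ _) _; lra.
have FT x : 0 <= x -> F x = tailint phi f x by move=> /FL; rewrite L0 subr0.
split=> // x x0; rewrite gu//; congr (_ * (_ + _)).
apply: eq_Rintegral => t; rewrite inE/= in_itv/= => /andP[t0 _]; by rewrite FT.
Qed.

End components.

(** * Limits at infinity through real and imaginary parts *)

Section complex_limits.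
Context {R : realType}.
Implicit Types h : R -> R[i].

Lemma Re_divR (z : R[i]) (a : R) : complex.Re (z / a%:C) = complex.Re z / a.
Proof. by rewrite realC_inv ReM/= mulr0 subr0. Qed.

Lemma Im_divR (z : R[i]) (a : R) : complex.Im (z / a%:C) = complex.Im z / a.
Proof. by rewrite realC_inv ImM/= mulr0 add0r. Qed.

Definition vanishes_at_infinity (h : R -> R) :=
  forall e : R, 0 < e -> exists2 N, 0 <= N & forall x, N <= x -> `|h x| <= e.

Lemma cvg0_parts h : (h : R -> Cfield R) x @[x --> +oo] --> (0 : Cfield R) <->
  vanishes_at_infinity (fun x => complex.Re (h x)) /\
  vanishes_at_infinity (fun x => complex.Im (h x)).
Proof.
split=> [/cvgrPdist_lt H|[Hr Hi]].
  have {}H (e : R) : 0 < e -> exists2 N, 0 <= N & forall x, N <= x -> `|h x| < e%:C.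
    move=> e0; have e0' : 0 < (e%:C : Cfield R) by rewrite ltcR.
    have [M [_ HM]] := H _ e0'.
    (* The filter at infinity speaks of x > M; adding 1 allows the weak inequality in N <= x. *)
    exists (Num.max 0 (M + 1)) => [|x]; first by rewrite le_max lexx.
    rewrite ge_max => /andP[_ Mx]; have := HM x.
    rewrite sub0r normrN; apply; lra.
  split=> e e0; have [N N0 HN] := H _ e0; exists N => // x /HN xe; apply: ltW.
    exact: normC_ge_Re.
  exact: normC_ge_Im.
apply/cvgrPdist_lt => /= e e0.
have eE : e = (complex.Re e)%:C by apply: eqC => //=; move: e0; rewrite ltcE => /andP[/eqP].
(* A third rather than a half: the bounds on the two parts are weak, and their sum must be strictly
   below [e]. *)
have e30 : 0 < complex.Re e / 3 by rewrite divr_gt0//; move: e0; rewrite ltcE => /andP[].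
have [N N0 HN] := Hr _ e30; have [N' N'0 HN'] := Hi _ e30.
exists (Num.max N N'); split; first exact: num_real.
move=> x; rewrite gt_max => /andP[/ltW/HN xr /ltW/HN' xi].
rewrite sub0r normrN [ltRHS]eE; apply: le_lt_trans (normC_le_parts _) _.
by rewrite ltcR; lra.
Qed.

End complex_limits.

(** * The operator with kernel Gg *)

Section green_operator.
Context {R : realType}.
Notation mu := (@lebesgue_measure R).
Notation D := (`](0 : R), +oo[%classic).
Variables (phi : R -> R) (gamma : R[i]).
Hypotheses (phi2 : L2 (cplx phi)) (phiW : W (cplx phi)).
Hypothesis phi_gt0 : forall x : R, 0 <= x -> 0 < phi x.
Hypothesis gamma_neq0 : gamma != 0.
Implicit Types (f g h : R -> R[i]).
Local Notation Re := complex.Re.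
Local Notation Im := complex.Im.

Let p x := Re (wderiv (cplx phi) x).

Let phiL2 : L2r D phi.
Proof. by have /L2P[] := phi2. Qed.

Let phip : primitive phi p.
Proof. by have /wderivP/is_wderivP[] := phiW. Qed.

Let pL2 : L2rloc p.
Proof. by have /wderivP/is_wderivP[/L2locP[]] := phiW. Qed.

(** The chosen weak derivative of phi is complex-valued, and real only almost everywhere: its
    imaginary part is a density of the constant 0. Hence [p] is its real part. *)
Lemma wderiv_phi_real :
  wderiv (cplx phi) = (fun x => (Re (wderiv (cplx phi) x))%:C) %[ae mu in D].
Proof.
have /wderivP/is_wderivP[_ _ pi] := phiW.
have := primitive_cst_ae0 pi (fun _ _ => erefl).
by apply: ae_mono => x H Dx; apply: eqC => //=; exact: H.
Qed.

Definition tailC f x : R[i] :=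
  tailint phi (fun t => Re (f t)) x +i* tailint phi (fun t => Im (f t)) x.

Definition usolC f x : R[i] :=
  usol phi (fun t => Re (f t)) x +i* usol phi (fun t => Im (f t)) x.

Definition green_sol f x : R[i] := (phi x)%:C * (gamma * tailC f 0 + usolC f x).

Lemma green_sol0 f : green_sol f 0 = (phi 0)%:C * (gamma * tailC f 0).
Proof. by congr (_ * _); apply: eqC; rewrite !partsE /= usol0 addr0. Qed.

(** The kernel is that of G plus gamma phi(x) phi(y). The second term integrates to gamma phi(x)
    F(0), since F(0) is the integral of phi f over the whole half line. *)
Lemma kernel_op_green f x : L2 f -> 0 <= x ->
  kernel_op (Gg phi gamma) f x = green_sol f x.
Proof.
move=> /L2P[Lr Li] x0.
have GE y : Gg phi gamma x y = (greenr phi x y)%:C + gamma * (phi x * phi y)%:C.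
  rewrite /Gg /green_kernel /xi /greenr /cplx; case: (leP x y) => xy.
    by rewrite psiE; apply: eqC; rewrite !partsE /=; ring.
  by rewrite psiE; apply: eqC; rewrite !partsE /=; ring.
have iGr := integrable_greenr phip phi_gt0 phiL2 Lr x0.
have iGi := integrable_greenr phip phi_gt0 phiL2 Li x0.
have ir := integrable_phiM phiL2 Lr; have ii := integrable_phiM phiL2 Li.
have iZ (c : R) (h0 : R -> R) : mu.-integrable D (EFin \o h0) -> mu.-integrable D (EFin \o (fun y => c * h0 y)).
  move=> ih; have := integrableZl _ c ih.
  by move=> /(_ (measurable_itv _)); apply: eq_integrable.
have T0 (h0 : R -> R) : tailint phi h0 0 = \int[mu]_(y in D) (phi y * h0 y) by [].
rewrite /kernel_op; move: GE; move: (Gg phi gamma x) => K GE.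
apply: eqC.
  rewrite !partsE /= !T0 mul0r subr0.
  rewrite [LHS](@eq_Rintegral _ _ _ mu _ (fun y => greenr phi x y * Re (f y) +
      ((phi x * Re gamma) * (phi y * Re (f y)) -
       (phi x * Im gamma) * (phi y * Im (f y))))); last first.
    by move=> y _; rewrite GE !partsE /=; ring.
  rewrite RintegralD//; last exact: (integrableB _ (iZ _ _ ir) (iZ _ _ ii)).
  rewrite RintegralB//; [|exact: iZ|exact: iZ].
  rewrite !RintegralZl// (greenr_integral phip)//.
  by ring.
rewrite !partsE /= !T0 mul0r addr0.
rewrite [LHS](@eq_Rintegral _ _ _ mu _ (fun y => greenr phi x y * Im (f y) +
    ((phi x * Re gamma) * (phi y * Im (f y)) +
     (phi x * Im gamma) * (phi y * Re (f y))))); last first.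
  by move=> y _; rewrite GE !partsE /=; ring.
rewrite RintegralD//; last exact: (integrableD _ (iZ _ _ ii) (iZ _ _ ir)).
rewrite RintegralD//; [|exact: iZ|exact: iZ].
rewrite !RintegralZl// (greenr_integral phip)//.
by ring.
Qed.

Definition green_sol' f x : R[i] :=
  (phi x)%:C * ((isq phi x)%:C * tailC f x) +
  (gamma * tailC f 0 + usolC f x) * (p x)%:C.

Lemma Re_green_sol f x : Re (green_sol f x) =
  phi x * (Re (gamma * tailC f 0) + usol phi (fun t => Re (f t)) x).
Proof. by rewrite /green_sol ReM /= mul0r subr0 ReD. Qed.

Lemma Im_green_sol f x : Im (green_sol f x) =
  phi x * (Im (gamma * tailC f 0) + usol phi (fun t => Im (f t)) x).
Proof. by rewrite /green_sol ImM /= mul0r addr0 ImD. Qed.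

Lemma green_sol_wderiv f : L2 f -> is_wderiv (green_sol f) (green_sol' f).
Proof.
move=> /L2P[Lr Li].
have rE x : phi x * (isq phi x * tailint phi (fun t => Re (f t)) x) +
    (Re (gamma * tailC f 0) + usol phi (fun t => Re (f t)) x) * p x = Re (green_sol' f x).
  by rewrite /green_sol' !partsE /=; ring.
have iE x : phi x * (isq phi x * tailint phi (fun t => Im (f t)) x) +
    (Im (gamma * tailC f 0) + usol phi (fun t => Im (f t)) x) * p x = Im (green_sol' f x).
  by rewrite /green_sol' !partsE /=; ring.
apply/is_wderivP; split.
- apply/L2locP; split.
    exact: L2rloc_eq rE (L2rloc_green phip phi_gt0 phiL2 pL2 _ Lr).
  exact: L2rloc_eq iE (L2rloc_green phip phi_gt0 phiL2 pL2 _ Li).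
- have := primitive_green phip phi_gt0 phiL2 (Re (gamma * tailC f 0)) Lr.
  move=> /(eq_primitive_deriv (fun x _ => rE x)).
  by apply: eq_primitive => x _; rewrite Re_green_sol.
- have := primitive_green phip phi_gt0 phiL2 (Im (gamma * tailC f 0)) Li.
  move=> /(eq_primitive_deriv (fun x _ => iE x)).
  by apply: eq_primitive => x _; rewrite Im_green_sol.
Qed.

Lemma green_sol_W f : L2 f -> W (green_sol f).
Proof. by move=> /green_sol_wderiv/W_intro. Qed.

Lemma tailC_wderiv f : L2 f -> is_wderiv (tailC f) (fun x => - ((phi x)%:C * f x)).
Proof.
move=> /L2P[Lr Li].
have rE x : -1 * (phi x * Re (f x)) = Re (- ((phi x)%:C * f x)).
  by rewrite !partsE /=; ring.
have iE x : -1 * (phi x * Im (f x)) = Im (- ((phi x)%:C * f x)).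
  by rewrite !partsE /=; ring.
have loc (h0 : R -> R) : L2r D h0 -> L2rloc (fun x => -1 * (phi x * h0 x)).
  move=> Lh; apply: (@L2rlocM _ (fun=> -1)); first by move=> ?; exact: cst_continuous.
  by apply: L2rlocM; [exact: primitive_continuous phip|exact: L2r_loc].
apply/is_wderivP; split.
- apply/L2locP; split; [exact: L2rloc_eq rE (loc _ Lr)|exact: L2rloc_eq iE (loc _ Li)].
- apply: eq_primitive_deriv (primitive_tailint phiL2 Lr) => x _.
  by rewrite -rE mulN1r.
- apply: eq_primitive_deriv (primitive_tailint phiL2 Li) => x _.
  by rewrite -iE mulN1r.
Qed.

Lemma phiC_neq0 x : 0 <= x -> (phi x)%:C != 0.
Proof.
by move=> x0; rewrite eq_complex /= negb_and (phi_neq0 phi_gt0).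
Qed.

(* phi (phi u)' - phi' (phi u) = phi^2 u' *)
Lemma wronsk_green_sol f g : L2 f -> (forall x, 0 <= x -> g x = green_sol f x) ->
  aeq (wronsk phi g) (tailC f).
Proof.
move=> Lf gE.
have dg : aeq (wderiv g) (green_sol' f).
  apply: wderiv_unique; apply: eq_is_wderiv (green_sol_wderiv Lf) => x x0.
  by rewrite gE.
move: dg wderiv_phi_real; apply: ae_mono2 => x dg dphi Dx.
rewrite /wronsk dg// dphi// -/(p x).
move: Dx; rewrite /= in_itv/= andbT => /ltW x0.
rewrite gE// /green_sol /green_sol'.
have i1 : phi x * phi x * isq phi x = 1.
  by rewrite /isq expr2 mulfV// mulf_neq0 ?(phi_neq0 phi_gt0).
transitivity ((phi x * phi x * isq phi x)%:C * tailC f x); last first.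
  by rewrite i1 mul1r.
by rewrite !rmorphM; ring.
Qed.

(** [tailC f] lies in [W], so it is the continuous representative of the Wronskian, and the value at
    0 in the boundary condition is F(0). *)
Lemma crep_green_sol f g : L2 f -> (forall x, 0 <= x -> g x = green_sol f x) ->
  Defs.aeW (wronsk phi g) /\
  forall x, 0 <= x -> crep (wronsk phi g) x = tailC f x.
Proof.
move=> Lf gE; have wT := wronsk_green_sol Lf gE.
have WT := W_intro (tailC_wderiv Lf).
by split; [exists (tailC f)|exact: crepE].
Qed.

Lemma cmeasurable_inv_phi : cmeasurable D (fun x => ((phi x)%:C)^-1).
Proof.
rewrite (_ : (fun x => _) = (fun x => ((phi x)^-1)%:C)); last first.
  by apply/funext => x; rewrite realC_inv.
apply: cmeasurable_real; apply: halfline_measurable.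
exact: (inv_phi_continuous phip phi_gt0).
Qed.

Lemma wderiv_crep_green_sol f g : L2 f -> (forall x, 0 <= x -> g x = green_sol f x) ->
  aeq (fun x => ((phi x)%:C)^-1 * wderiv (crep (wronsk phi g)) x) (fun x => - f x).
Proof.
move=> Lf gE; have [wW cE] := crep_green_sol Lf gE.
have : aeq (wderiv (crep (wronsk phi g))) (fun x => - ((phi x)%:C * f x)).
  apply: wderiv_unique; apply: eq_is_wderiv (tailC_wderiv Lf) => x x0.
  by rewrite cE.
apply: ae_mono => x H Dx; rewrite H// mulrN mulKf//.
by apply: phiC_neq0; move: Dx; rewrite /= in_itv/= andbT => /ltW.
Qed.

(** In the theorem, [L2 (green_sol f)] is supplied by membership of the range in [L2class]. *)
Lemma green_sol_Dg f : L2 f -> L2 (green_sol f) -> Dg phi gamma (green_sol f).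
Proof.
move=> Lf Lg; have gE : forall x, 0 <= x -> green_sol f x = green_sol f x by [].
have [wW cE] := crep_green_sol Lf gE.
have /L2P[Lr Li] := Lf.
split.
- by split=> //; exact: green_sol_W.
(* Since g(0) = phi(0) gamma F(0), the boundary condition reads F(0) = F(0). *)
- rewrite cE// green_sol0.
  have p0 := phiC_neq0 (lexx 0).
  by field; rewrite p0 gamma_neq0.
- exact: wW.
- have [Wc _] := crepP wW.
  have LNf : L2 (fun x => - f x) by exact: L2N.
  apply: L2_aeq LNf _ (aeq_sym (wderiv_crep_green_sol Lf gE)).
  apply: cmeasurableM; first exact: cmeasurable_inv_phi.
  exact: cmeasurable_wderiv.
- apply/cvg0_parts; split=> e e0.
    have [N N0 HN] := green_ratio phip phi_gt0 phiL2 (Re (gamma * tailC f 0)) Lr e0.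
    by exists N => // x Nx; rewrite Re_divR Re_green_sol HN.
  have [N N0 HN] := green_ratio phip phi_gt0 phiL2 (Im (gamma * tailC f 0)) Li e0.
  by exists N => // x Nx; rewrite Im_divR Im_green_sol HN.
Qed.

Lemma Dg_green_sol g : Dg phi gamma g ->
  exists2 f, L2 f & forall x, 0 <= x -> g x = green_sol f x.
Proof.
move=> [[Lg Wg] g0 wW LF glim].
have [Wc wc] := crepP wW.
pose f x := - (((phi x)%:C)^-1 * wderiv (crep (wronsk phi g)) x).
have Lf : L2 f by exact: L2N.
have /L2P[Lr Li] := Lf.
have /is_wderivP[_ pgr pgi] := wderivP Wg.
have /is_wderivP[_ pcr pci] := wderivP Wc.
have /cvg0_parts[limr limi] := glim.
have wE x : 0 <= x -> wderiv (crep (wronsk phi g)) x = - ((phi x)%:C * f x).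
  by move=> x0; rewrite /f mulrN opprK mulVKf// phiC_neq0.
have [Fr gr] : (forall x, 0 <= x -> Re (crep (wronsk phi g) x) = tailint phi (fun t => Re (f t)) x) /\
    (forall x, 0 <= x -> Re (g x) = phi x * (Re (g 0) / phi 0 + usol phi (fun t => Re (f t)) x)).
  apply: (green_component phip phi_gt0 phiL2 Lr pgr).
  - by apply: eq_primitive_deriv pcr => x x0; rewrite wE// !partsE /=; ring.
  - move: wc wderiv_phi_real; apply: ae_mono2 => x wc dphi Dx.
    by rewrite -wc// /wronsk dphi// -/(p x) !partsE /=; ring.
  - move=> e e0; have [N N0 HN] := limr e e0; exists N => // x Nx.
    by rewrite -Re_divR HN.
have [Fi gi] : (forall x, 0 <= x -> Im (crep (wronsk phi g) x) = tailint phi (fun t => Im (f t)) x) /\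
    (forall x, 0 <= x -> Im (g x) = phi x * (Im (g 0) / phi 0 + usol phi (fun t => Im (f t)) x)).
  apply: (green_component phip phi_gt0 phiL2 Li pgi).
  - by apply: eq_primitive_deriv pci => x x0; rewrite wE// !partsE /=; ring.
  - move: wc wderiv_phi_real; apply: ae_mono2 => x wc dphi Dx.
    by rewrite -wc// /wronsk dphi// -/(p x) !partsE /=; ring.
  - move=> e e0; have [N N0 HN] := limi e e0; exists N => // x Nx.
    by rewrite -Im_divR HN.
have F0 : crep (wronsk phi g) 0 = tailC f 0 by apply: eqC; [exact: Fr|exact: Fi].
(* The boundary condition fixes the constant left free in both components: g(0) / phi(0) = gamma
   F(0). *)
have g0E : gamma * tailC f 0 = g 0 / (phi 0)%:C.
  rewrite -F0 g0; have p0 := phiC_neq0 (lexx 0).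
  by field; rewrite p0 gamma_neq0.
exists f => // x x0; apply: eqC.
  by rewrite Re_green_sol g0E Re_divR; exact: gr.
by rewrite Im_green_sol g0E Im_divR; exact: gi.
Qed.

Lemma kernel_op_aeq f : L2 f -> aeq (kernel_op (Gg phi gamma) f) (green_sol f).
Proof.
move=> Lf; apply: aeW => x; rewrite /= in_itv/= andbT => /ltW x0.
exact: kernel_op_green.
Qed.

(** [H] picks some preimage, not necessarily the one constructed above. Every preimage represents
    [g] almost everywhere, hence everywhere on [0, oo) because both sides lie in [W]. *)
Lemma H_green_sol g : Dg phi gamma g ->
  L2 (H phi gamma g) /\ forall x, 0 <= x -> g x = green_sol (H phi gamma g) x.
Proof.
move=> Dgg; have [f Lf gE] := Dg_green_sol Dgg.
have [LH HE] : L2 (H phi gamma g) /\ aeq (kernel_op (Gg phi gamma) (H phi gamma g)) g.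
  apply: (xgetPex (fun=> 0) (P := [set f | L2 f /\ aeq (kernel_op (Gg phi gamma) f) g])).
  exists f; split=> //; apply: aeq_trans (kernel_op_aeq Lf) _.
  by apply: aeW => x; rewrite /= in_itv/= andbT => /ltW x0; rewrite gE.
split=> // x x0; have [[_ Wg] _ _ _ _] := Dgg.
apply: W_aeq => //; first exact: green_sol_W.
exact: aeq_trans (aeq_sym HE) (kernel_op_aeq LH).
Qed.

Hypothesis G_bounded : bounded_kernel (G phi).

(** Boundedness of G enters here, applied to |f|, to provide the hypothesis of [tailint_L2] and
    [green_form]. *)
Lemma green_norm_L2 (f : R -> R) : L2r D f ->
  L2r D (fun x => phi x * usol phi (fun t => `|f t|) x).
Proof.
move=> Lf; have LN := L2r_norm (measurable_itv _) Lf.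
have [M HM] := G_bounded.
have LC : L2 (cplx (fun t => `|f t|)).
  apply/L2P; split=> //=; split; first exact: measurable_cst.
  by rewrite expr0n/= integral0.
have [_ /L2P[LG _] _] := HM _ LC.
have pu := primitive_usol phip phi_gt0 phiL2 LN.
apply: (L2r_le _ _ LG) => //.
  apply: measurable_funM; first by case: phiL2.
  exact: halfline_measurable (primitive_continuous pu).
move=> x /=; rewrite in_itv/= andbT => /ltW x0.
rewrite -(greenr_integral phip)// le_eqVlt; apply/orP; left; apply/eqP; congr `|_|.
apply: eq_Rintegral => y _.
rewrite /G /green_kernel /greenr /cplx; case: (leP x y) => xy.
  by rewrite psiE !partsE /=; ring.
by rewrite psiE !partsE /=; ring.
Qed.

(** Sesquilinear expansion into four instances of [green_form]. The rank one part contributes the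
    pairing of f1 with gamma F2(0) phi, which is F1(0) times the conjugate of gamma F2(0). *)
Lemma green_form_complex f1 f2 : L2 f1 -> L2 f2 ->
  let F x := tailC f1 x * (tailC f2 x)^* * (isq phi x)%:C in
  cintegrable D F /\
  inner f1 (green_sol f2) =
    cint D F + tailC f1 0 * (gamma * tailC f2 0)^*.
Proof.
move=> L1 L2' F; have /L2P[r1 i1] := L1; have /L2P[r2 i2] := L2'.
have gr1 := green_norm_L2 r1; have gi1 := green_norm_L2 i1.
have gr2 := green_norm_L2 r2; have gi2 := green_norm_L2 i2.
have [Arr Brr Err] := green_form phip phi_gt0 phiL2 r1 r2 gr1 gr2.
have [Aii Bii Eii] := green_form phip phi_gt0 phiL2 i1 i2 gi1 gi2.
have [Air Bir Eir] := green_form phip phi_gt0 phiL2 i1 r2 gi1 gr2.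
have [Ari Bri Eri] := green_form phip phi_gt0 phiL2 r1 i2 gr1 gi2.
have pr1 := integrable_phiM phiL2 r1; have pi1 := integrable_phiM phiL2 i1.
have iD (h1 h2 : R -> R) : mu.-integrable D (EFin \o h1) -> mu.-integrable D (EFin \o h2) ->
    mu.-integrable D (EFin \o (fun x => h1 x + h2 x)).
  move=> j1 j2; have := integrableD _ j1 j2.
  by move=> /(_ (measurable_itv _)); apply: eq_integrable.
have iB (h1 h2 : R -> R) : mu.-integrable D (EFin \o h1) -> mu.-integrable D (EFin \o h2) ->
    mu.-integrable D (EFin \o (fun x => h1 x - h2 x)).
  move=> j1 j2; have := integrableB _ j1 j2.
  by move=> /(_ (measurable_itv _)); apply: eq_integrable.
have FrE x : Re (F x) =
    tailint phi (fun t => Re (f1 t)) x * tailint phi (fun t => Re (f2 t)) x * isq phi x +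
    tailint phi (fun t => Im (f1 t)) x * tailint phi (fun t => Im (f2 t)) x * isq phi x.
  by rewrite /F !partsE /=; ring.
have FiE x : Im (F x) =
    tailint phi (fun t => Im (f1 t)) x * tailint phi (fun t => Re (f2 t)) x * isq phi x -
    tailint phi (fun t => Re (f1 t)) x * tailint phi (fun t => Im (f2 t)) x * isq phi x.
  by rewrite /F !partsE /=; ring.
split.
  split.
    by apply: eq_integrable (iD _ _ Arr Aii) => // x _; congr EFin; exact/esym/FrE.
  by apply: eq_integrable (iB _ _ Air Ari) => // x _; congr EFin; exact/esym/FiE.
(* An opaque name for the constant keeps its real and imaginary parts from being expanded into those
   of gamma. *)
have [c cE] : {c | c = gamma * tailC f2 0} by exists (gamma * tailC f2 0).
have ReE : \int[mu]_(x in D) Re (f1 x * (green_sol f2 x)^*) =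
    \int[mu]_(x in D) Re (F x) + (Re (tailC f1 0) * Re c + Im (tailC f1 0) * Im c).
  rewrite (@eq_Rintegral _ _ _ mu _ _ (fun x => Re (F x)) (fun x _ => FrE x)).
  rewrite RintegralD// -Err -Eii.
  rewrite [Re (tailC _ _) * _]mulrC [Im (tailC _ _) * _]mulrC.
  rewrite -[X in _ + X + _]mul1r.
  apply: etrans (Rintegral_comb 1 (Re c) (Im c) Brr Bii pr1 pi1).
  apply: eq_Rintegral => x _.
  rewrite ReM ReJ ImJ Re_green_sol Im_green_sol -cE.
  move: (usol _ _ _) (usol _ _ _) (Re c) (Im c) (Re (f1 x)) (Im (f1 x)) (phi x).
  by move=> a1 a2 a3 a4 a5 a6 a7; ring.
have ImE : \int[mu]_(x in D) Im (f1 x * (green_sol f2 x)^*) =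
    \int[mu]_(x in D) Im (F x) + (Im (tailC f1 0) * Re c + Re (tailC f1 0) * - Im c).
  rewrite (@eq_Rintegral _ _ _ mu _ _ (fun x => Im (F x)) (fun x _ => FiE x)).
  rewrite RintegralB// -Eir -Eri.
  rewrite [Re (tailC _ _) * _]mulrC [Im (tailC _ _) * _]mulrC.
  rewrite -mulN1r.
  apply: etrans (Rintegral_comb (-1) (Re c) (- Im c) Bir Bri pi1 pr1).
  apply: eq_Rintegral => x _.
  rewrite ImM ReJ ImJ Re_green_sol Im_green_sol -cE.
  move: (usol _ _ _) (usol _ _ _) (Re c) (Im c) (Re (f1 x)) (Im (f1 x)) (phi x).
  by move=> a1 a2 a3 a4 a5 a6 a7; ring.
rewrite -cE; apply: eqC.
  by rewrite ReD ReM ReJ ImJ mulrN opprK; exact: ReE.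
by rewrite ImD ImM ReJ ImJ [X in _ + X]addrC; exact: ImE.
Qed.

Lemma Dg_form g1 g2 : Dg phi gamma g1 -> Dg phi gamma g2 ->
  let q x :=
    ((phi x)%:C * wderiv g1 x - wderiv (cplx phi) x * g1 x) *
    ((phi x)%:C * (wderiv g2 x)^* - wderiv (cplx phi) x * (g2 x)^*) *
    (((phi x)%:C) ^+ 2)^-1 in
  cintegrable `]0, +oo[ q /\
  inner (H phi gamma g1) g2 =
    cint `]0, +oo[ q + g1 0 * (g2 0)^* / (gamma * ((phi 0)%:C) ^+ 2).
Proof.
move=> D1 D2 q.
have [Lf1 E1] := H_green_sol D1.
have [Lf2 E2] := H_green_sol D2.
set f1 := H phi gamma g1 in Lf1 E1 *; set f2 := H phi gamma g2 in Lf2 E2.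
have [iF inE'] := green_form_complex Lf1 Lf2.
have w1 := wronsk_green_sol Lf1 E1.
have w2 := wronsk_green_sol Lf2 E2.
have [[_ W1] _ _ _ _] := D1; have [[_ W2] _ _ _ _] := D2.
have mphi : cmeasurable D (fun x => (phi x)%:C) by exact: (cmeasurable_W phiW).
have mq : cmeasurable D q.
  apply: cmeasurableM; last first.
    rewrite (_ : (fun x => _) = (fun x => ((phi x)%:C)^-1 * ((phi x)%:C)^-1)).
      by apply: cmeasurableM; exact: cmeasurable_inv_phi.
    by apply/funext => x; rewrite expr2 invfM.
  apply: cmeasurableM.
    apply: cmeasurableB; apply: cmeasurableM => //.
    - exact: cmeasurable_wderiv.
    - exact: cmeasurable_wderiv.
    - exact: cmeasurable_W.
  apply: cmeasurableB; apply: cmeasurableM => //.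
  - by apply: cmeasurableJ; exact: cmeasurable_wderiv.
  - exact: cmeasurable_wderiv.
  - by apply: cmeasurableJ; exact: cmeasurable_W.
(* The second factor of [q] is the conjugate of the Wronskian of g2 wherever the weak derivative of
   phi is real. *)
have qF : aeq (fun x => tailC f1 x * (tailC f2 x)^* * (isq phi x)%:C) q.
  have := ae_mono2 (fun x (a : D x -> _) (b : D x -> _) Dx => conj (a Dx) (b Dx)) w1 w2.
  have := wderiv_phi_real.
  apply: ae_mono2 => x dphi w12 Dx; have [w1x w2x] := w12 Dx.
  rewrite -w1x -w2x /q /wronsk dphi// -/(p x); congr (_ * _ * _).
    apply: eqC; rewrite !partsE /=; ring.
  by rewrite /isq -rmorphXn/= realC_inv.
have [iq ->] := cint_ae iF mq qF.
split=> //.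
transitivity (inner f1 (green_sol f2)).
  by apply: eqC; apply: eq_Rintegral => x; rewrite inE/= in_itv/= andbT => /ltW x0; rewrite E2.
rewrite inE'; congr (_ + _).
(* With gi(0) = phi(0) gamma Fi(0), the denominator cancels phi(0)^2 and the gamma coming from g1;
   the conjugated gamma from g2 remains. *)
rewrite (E1 _ (lexx 0)) (E2 _ (lexx 0)) !green_sol0.
have p0 := phiC_neq0 (lexx 0).
rewrite [X in _ = _ * X / _](_ : _ = (phi 0)%:C * (gamma * tailC f2 0)^*).
  by field; rewrite p0 gamma_neq0.
by apply: eqC; rewrite !partsE /=; ring.
Qed.

(** The formula uses the opposite Wronskian phi' g - phi g'. Its continuous representative is -F,
    obtained as the tail function of -f, so the facts on [tailC] apply without a separate study of
    [crep] under negation. *)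
Lemma Dg_H g : Dg phi gamma g ->
  aeq (H phi gamma g)
      (fun x => ((phi x)%:C)^-1 *
         wderiv (crep (fun t => wderiv (cplx phi) t * g t
                                - (phi t)%:C * wderiv g t)) x).
Proof.
move=> Dgg; have [Lf gE] := H_green_sol Dgg.
set f := H phi gamma g in Lf gE *.
have wT := wronsk_green_sol Lf gE.
have LNf := L2N Lf.
have wN := tailC_wderiv LNf.
have TN x : 0 <= x -> tailC (fun t => - f t) x = - tailC f x.
  move=> x0; have /L2P[fr fi] := Lf.
  have tl (h0 : R -> R) : L2r D h0 -> mu.-integrable `]x, +oo[ (EFin \o (fun t => phi t * h0 t)).
    move=> /(integrable_phiM phiL2); apply: integrableS => // t/=.
    by rewrite !in_itv/= !andbT; exact: le_lt_trans.
  apply: eqC; rewrite !partsE /= /tailint -mulN1r -RintegralZl//; do ?exact: tl.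
    by apply: eq_Rintegral => t _; rewrite ReN mulrN mulN1r.
  by apply: eq_Rintegral => t _; rewrite ImN mulrN mulN1r.
have cE := crepE (W_intro wN).
have : aeq (wderiv (crep (fun t => wderiv (cplx phi) t * g t - (phi t)%:C * wderiv g t)))
    (fun x => - ((phi x)%:C * - f x)).
  apply: wderiv_unique; apply: eq_is_wderiv wN => x x0; rewrite (cE _ _ x x0)//.
  move: wT; apply: ae_mono => y wT Dy; rewrite TN; last first.
    by move: Dy; rewrite /= in_itv/= andbT => /ltW.
  by rewrite -wT// /wronsk opprB.
apply: ae_mono => x HH Dx; rewrite HH// mulrN mulKf ?opprK//.
by apply: phiC_neq0 => //; move: Dx; rewrite /= in_itv/= andbT => /ltW.
Qed.

End green_operator.

Theorem theorem17 (R : realType) (phi : R -> R)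
    (phiL2 : L2 (cplx phi)) (phiW : W (cplx phi))
    (phi_gt0 : forall x : R, 0 <= x -> 0 < phi x)
    (G_bounded : bounded_kernel (G phi))
    (gamma : R[i]) (gamma_neq0 : gamma != 0) :
  [/\ Dom_H phi gamma = Ran_Gg phi gamma /\
      Ran_Gg phi gamma = L2class (Dg phi gamma),
      forall g : R -> R[i], Dg phi gamma g ->
        aeq (H phi gamma g)
            (fun x => ((phi x)%:C)^-1 *
               wderiv (crep (fun t => wderiv (cplx phi) t * g t
                                      - (phi t)%:C * wderiv g t)) x) &
      forall g1 g2 : R -> R[i], Dg phi gamma g1 -> Dg phi gamma g2 ->
        let q x :=
          ((phi x)%:C * wderiv g1 x - wderiv (cplx phi) x * g1 x) *
          ((phi x)%:C * (wderiv g2 x)^* - wderiv (cplx phi) x * (g2 x)^*) *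
          (((phi x)%:C) ^+ 2)^-1 in
        cintegrable `]0, +oo[ q /\
        inner (H phi gamma g1) g2 =
          cint `]0, +oo[ q + g1 0 * (g2 0)^* / (gamma * ((phi 0)%:C) ^+ 2)].
Proof.
split; first split.
- apply/seteqP; split=> g [Lg].
    by move=> [f Lf fg]; split=> //; exists (kernel_op (Gg phi gamma) f); [exists f|exact: aeq_sym].
  by move=> [_ [f Lf <-] gf]; split=> //; exists f => //; exact: aeq_sym.
- apply/seteqP; split=> g [Lg].
    move=> [_ [f Lf <-] gf]; split=> //.
    have gG := aeq_trans gf (kernel_op_aeq gamma phiL2 phiW phi_gt0 Lf).
    exists (green_sol phi gamma f) => //; apply: green_sol_Dg => //.
    (* Square integrability passes from [g] to [green_sol] along almost everywhere equality;
       measurability comes from [W]. *)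
    apply: L2_aeq Lg _ gG; apply: cmeasurable_W; exact: green_sol_W.
  move=> [h Dh gh]; split=> //.
  have [f Lf hE] := Dg_green_sol phiL2 phiW phi_gt0 gamma_neq0 Dh.
  exists (kernel_op (Gg phi gamma) f); first by exists f.
  apply: aeq_trans gh _; apply: aeq_trans (aeq_sym (kernel_op_aeq gamma phiL2 phiW phi_gt0 Lf)).
  by apply: aeW => x; rewrite /= in_itv/= andbT => /ltW x0; rewrite hE.
- by move=> g; exact: Dg_H.
- by move=> g1 g2; exact: Dg_form.
Qed.
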